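(* Let $(X_t)_{t\in\mathbb{Z}}$ be the RCAR process of order $p$ with serially correlated coefficients described in the context, and let $\widehat\theta_n$ be the OLS estimator defined there. Assume that $\Theta\subset\Theta_2\setminus\Theta^*$ (where $\Theta$ is the space in which the parameters live and $\Theta_2$, $\Theta^*$ are defined in the context). Then, as $n\to+\infty$, we have the almost sure convergence $$\widehat\theta_n\longrightarrow\theta^*=\Lambda_0^{-1}L_1\quad\text{a.s.}$$
   Context: Model: $X_t=\sum_{k=1}^p(\theta_k+\alpha_k\eta_{k,t-1}+\eta_{k,t})X_{t-k}+\varepsilon_t$, $t\in\mathbb{Z}$, with $\theta=(\theta_1,\dots,\theta_p)^T$, $\alpha=(\alpha_1,\dots,\alpha_p)^T$ real. $(\varepsilon_t)$ and $(\eta_{k,t})$ are uncorrelated strong white noises (that is, i.i.d. sequences) with $q$th-order moments $\sigma_q$ and $\tau_{k,q}$ respectively, and $(\eta_{k,t})$ and $(\eta_{\ell,t})$ are uncorrelated for $k\neq\ell$. Any odd moment of $\varepsilon_0$ and $\eta_{k,0}$ is zero as soon as it exists. Vector form: $\Phi_t=(C_\theta+N_{t-1}D_\alpha+N_t)\Phi_{t-1}+E_t$ with $\Phi_t=(X_t,\dots,X_{t-p+1})^T$, $E_t=(\varepsilon_t,0,\dots,0)^T$, $N_t$ the $p\times p$ matrix with first row $(\eta_{1,t},\dots,\eta_{p,t})$ and $0$ elsewhere, $D_\alpha=\mathrm{diag}(\alpha_1,\dots,\alpha_p)$, $C_\theta$ the companion matrix (first row $(\theta_1,\dots,\theta_p)$,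 ones on the first subdiagonal, zeros elsewhere). It is assumed throughout that $\mathbb{E}[\ln\Vert C_\theta+N_0D_\alpha+N_1\Vert]<0$ (for a matrix norm) and $\mathbb{E}[\ln^+|\varepsilon_0|]<+\infty$; the process is then strictly stationary and ergodic, and $\Phi_0$ is assumed to follow its stationary distribution. OLS estimator from the trajectory $(X_{-p+1},\dots,X_n)$: $\widehat\theta_n=S_{n-1}^{-1}\sum_{t=1}^n\Phi_{t-1}X_t$ with $S_n=\sum_{t=0}^n\Phi_t\Phi_t^T$. Autocovariances: $\ell_i=\mathbb{E}[X_iX_0]$, $\Lambda_0=(\ell_{|i-j|})_{1\leq i,j\leq p}$, $L_1=(\ell_1,\dots,\ell_p)^T$. Moment sets: for $m=2,4$, $\Theta_m$ is the set of parameters $\{\theta,\alpha,\sigma_q,\tau_{k,q'}\}$ such that $\mathbb{E}[\eta_{k,t}^aX_t^m]<+\infty$ for $a\in\{0,\dots,m\}$ and $k\in\{1,\dots,p\}$, where $\sigma_q$ and $\tau_{k,q'}$ generically name the highest-order moments of $(\varepsilon_t)$ and $(\eta_{k,t})$ needed for this ($q=m$ and $q'=2m$). Pathological set $\Theta^*$: it consists of the situations where $\Lambda_0$ is non-invertible, or $2\beta_1=1$, or $\alpha_1\beta_1=1$, or $\det(I_p-K)=0$, or $s_0=1$, or $U^T(I_p-K)^{-1}U_0=1-s_0$, with the following notation. $\beta_1=\alpha_1\tau_{1,2}$ and $\beta_2=\alpha_2\tau_{2,2}+\dots+\alpha_p\tau_{p,2}$. $M_\theta$ is the $p\times p$ matrix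 with entries $\theta_{i-j+1}\mathbf{1}_{\{j\leq i\}}+\theta_{i+j-1}\mathbf{1}_{\{j\geq2,\,i+j-1\leq p\}}$; $B$ is the $p\times p$ matrix with $(1,2)$ entry $\beta_2$, entries $\beta_1$ on the first subdiagonal, and zeros elsewhere; $M_{\alpha,\beta}=\mathrm{diag}(\frac1{1-2\beta_1},1,\dots,1)(M_\theta+B)$. $U_0$ is the first column of $M_{\alpha,\beta}$ and $K$ is the remaining part of $M_{\alpha,\beta}$ to which a zero column is added on the right. Next, $$s_0=\left(1+\alpha_1\theta_2+\frac{2\alpha_1\theta_1^2}{1-2\beta_1}+\frac{\sigma_2}{1-\alpha_1\beta_1}\right)\tau_{1,2}+\sum_{k=2}^p(1+\alpha_k^2)\tau_{k,2}$$ ($\theta_2$ read as $0$ if $p=1$). Finally $U^T=(u_1,\dots,u_{p-1},0)$ is the vector in the decomposition $$\sum_{t=1}^nX_t^2=\frac{U^T}{1-s_0}\sum_{t=1}^n\Phi_{t-1}X_t+\Big(\ell_0-\frac{U^TL_1}{1-s_0}\Big)n+M'_n+R'_n,$$ where $M'_n$ is a martingale for the filtration $\mathcal{F}_0^*=\sigma(\Phi_0,\eta_{1,0},\dots,\eta_{p,0})$, $\mathcal{F}_n^*=\sigma(\Phi_0,\eta_{1,0},\dots,\eta_{p,0},(\varepsilon_1,\eta_{1,1},\dots,\eta_{p,1}),\dots,(\varepsilon_n,\eta_{1,n},\dots,\eta_{p,n}))$, and $R'_n$ is made of second-order isolated terms, i.e. terms of the form $\prod_{i=1}^2X_{t-d_i}\eta_{k_i,t-d_i'}^{a_i}$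 with $0\leq d_i'\leq d_i$, $a_i\in\{0,1\}$, $1\leq k_i\leq p$. *)

(* Defs.v *)
From HB Require Import structures.
From mathcomp Require Export all_boot all_order all_algebra.
From mathcomp Require Export all_classical all_reals all_analysis.
Export numFieldNormedType.Exports.

Set Implicit Arguments.
Unset Strict Implicit.
Unset Printing Implicit Defensive.
Import Order.TTheory GRing.Theory Num.Theory.
Local Open Scope classical_set_scope.
Local Open Scope ring_scope.

Section Probability.
Context {d : measure_display} {T : measurableType d} {R : realType}.
Variable P : probability T R.

Definition Ex (Y : T -> R) : R := fine ('E_P[Y])%E.

Definition has_moment (Y : T -> R) (q : nat) : Prop :=
  P.-integrable setT (fun w => (Y w ^+ q)%:E).

Definition mutually_independent (I : eqType) {d' : measure_display}
    {E : measurableType d'} (Y : I -> T -> E) : Prop :=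
  forall (s : seq I) (A : I -> set E), uniq s -> (forall i, measurable (A i)) ->
    (P (\bigcap_(i in [set` s]) (Y i @^-1` A i)) =
     \prod_(i <- s) P (Y i @^-1` A i))%E.

Definition identically_distributed (I : Type) {d' : measure_display}
    {E : measurableType d'} (Y : I -> T -> E) : Prop :=
  forall (i j : I) (A : set E), measurable A ->
    P (Y i @^-1` A) = P (Y j @^-1` A).

Definition uncorrelated (Y Z : int -> T -> R) : Prop :=
  forall t s : int, covariance P (Y t) (Z s) = 0%E.

Definition odd_moments_vanish (Y : T -> R) : Prop :=
  forall q : nat, odd q -> has_moment Y q -> ('E_P[fun w => (Y w ^+ q)%R] = 0)%E.

Definition strictly_stationary (X : int -> T -> R) : Prop :=
  forall (n : nat) (t : 'I_n -> int) (h : int) (A : set (n.-tuple R)),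
    measurable A ->
    P ((fun w => [tuple X (t i + h) w | i < n]) @^-1` A) =
    P ((fun w => [tuple X (t i) w | i < n]) @^-1` A).

Definition martingale (F : nat -> set (set T)) (M : nat -> T -> R) : Prop :=
  forall n : nat,
    [/\ forall A : set R, measurable A -> F n (M n @^-1` A),
        P.-integrable setT (EFin \o M n) &
        forall B : set T, F n B ->
          (\int[P]_(w in B) (M n.+1 w)%:E = \int[P]_(w in B) (M n w)%:E)%E].

End Probability.

Section Matrices.
Context {R : realType} {p : nat}.

Definition is_matrix_norm (N : 'M[R]_p -> R) : Prop :=
  [/\ forall A, N A = 0 -> A = 0,
      forall a A, N (a *: A) = `|a| * N A,
      forall A B, N (A + B) <= N A + N B &
      forall A B, N (A *m B) <= N A * N B].

(* Coordinates are numbered from 1, and read as 0 outside {1, ..., p}. *)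
Definition coord (v : 'cV[R]_p) (k : nat) : R :=
  if k is j.+1 then (if insub j is Some i then v i 0 else 0) else 0.

(* Column of 0-based index j, and 0 if there is no such column. *)
Definition column (A : 'M[R]_p) (j : nat) : 'cV[R]_p :=
  if insub j is Some k then col k A else 0.

Definition companion (theta : 'cV[R]_p) : 'M[R]_p :=
  \matrix_(i, j) (if i == 0%N :> nat then theta j 0
                  else (i == j.+1 :> nat)%:R).

Definition Mtheta (theta : 'cV[R]_p) : 'M[R]_p :=
  \matrix_(i, j)
    ((if (j <= i)%N then coord theta (i - j + 1) else 0) +
     (if (0 < j)%N && (i + j + 1 <= p)%N then coord theta (i + j + 1) else 0)).

Section Coefficients.
(* tau2 is the vector (tau_{1,2}, ..., tau_{p,2}). *)
Variables (theta alpha tau2 : 'cV[R]_p) (sigma2 : R).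

Definition beta1 : R := coord alpha 1 * coord tau2 1.
Definition beta2 : R := \sum_(2 <= k < p.+1) coord alpha k * coord tau2 k.

Definition Bmat : 'M[R]_p :=
  \matrix_(i, j)
    (if (i == 0%N :> nat) && (j == 1%N :> nat) then beta2
     else if i == j.+1 :> nat then beta1 else 0).

Definition Malphabeta : 'M[R]_p :=
  diag_mx (\row_i (if i == 0%N :> nat then (1 - 2 * beta1)^-1 else 1))
  *m (Mtheta theta + Bmat).

Definition U0 : 'cV[R]_p := column Malphabeta 0.
Definition Kmat : 'M[R]_p := \matrix_(i, j) column Malphabeta j.+1 i 0.

Definition s0 : R :=
  (1 + coord alpha 1 * coord theta 2
     + 2 * coord alpha 1 * coord theta 1 ^+ 2 / (1 - 2 * beta1)
     + sigma2 / (1 - coord alpha 1 * beta1)) * coord tau2 1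
  + \sum_(2 <= k < p.+1) (1 + coord alpha k ^+ 2) * coord tau2 k.

End Coefficients.
End Matrices.

Section Model.
Context {d : measure_display} {T : measurableType d} {R : realType}.
Context (P : probability T R) {p : nat}.
Variables (theta alpha : 'cV[R]_p).
Variables (eps : int -> {RV P >-> R}) (eta : 'I_p -> int -> {RV P >-> R}).
Variable X : int -> {RV P >-> R}.

(* The index k : 'I_p stands for the lag k + 1. *)
Definition rcar_equation : Prop :=
  forall t : int, {ae P, forall w,
    X t w = \sum_(k < p)
        (theta k 0 + alpha k 0 * eta k (t - 1) w + eta k t w)
          * X (t - (k.+1)%:Z) w
      + eps t w}.

Definition innovation (t : int) (w : T) : p.+1.-tuple R :=
  [the p.+1.-tuple R of eps t w :: [tuple eta k t w | k < p]].

(* Strong white noises are read jointly: the vectors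
   (eps_t, eta_{1,t}, ..., eta_{p,t}) are i.i.d. over t, and their coordinates
   are uncorrelated, but not necessarily independent of each other. *)
Definition strong_white_noises : Prop :=
  [/\ mutually_independent P innovation,
      identically_distributed P innovation,
      (forall k : 'I_p, uncorrelated P eps (eta k)) /\
        (forall k l : 'I_p, k != l -> uncorrelated P (eta k) (eta l)) &
      odd_moments_vanish P (eps 0) /\
        (forall k : 'I_p, odd_moments_vanish P (eta k 0))].

Definition Nmat (t : int) (w : T) : 'M[R]_p :=
  \matrix_(i, j) (if i == 0%N :> nat then eta j t w else 0).

(* lne 0 = -oo, whereas ln 0 = 0. The bound on the positive part says that the
   expectation of the logarithm is well defined: extended-real integrals with
   infinite positive and negative parts evaluate to -oo. *)
Definition stability : Prop :=
  (exists N : 'M[R]_p -> R,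
    let A w := companion theta + Nmat 0 w *m diag_mx alpha^T + Nmat 1 w in
    [/\ is_matrix_norm N,
        (\int[P]_w Order.max 0 (lne (N (A w))%:E) < +oo)%E &
        (\int[P]_w lne (N (A w))%:E < 0)%E]) /\
  (\int[P]_w Order.max 0 (lne `|eps 0 w|%:E) < +oo)%E.

Definition Phi (t : int) (w : T) : 'cV[R]_p :=
  \col_(i < p) X (t - (i : nat)%:Z) w.

Definition Smat (n : nat) (w : T) : 'M[R]_p :=
  \sum_(0 <= t < n.+1) Phi t%:Z w *m (Phi t%:Z w)^T.

Definition theta_hat (n : nat) (w : T) : 'cV[R]_p :=
  invmx (Smat n.-1 w) *m
    (\sum_(1 <= t < n.+1) X t%:Z w *: Phi (t%:Z - 1) w).

Definition ell (i : nat) : R := Ex P (fun w => X i%:Z w * X 0 w).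

Definition Lambda0 : 'M[R]_p := \matrix_(i, j) ell `|i%:Z - j%:Z|%N.
Definition L1 : 'cV[R]_p := \col_(i < p) ell i.+1.

Definition sigma (q : nat) : R := Ex P (fun w => eps 0 w ^+ q).
Definition tau (q : nat) : 'cV[R]_p :=
  \col_k Ex P (fun w => eta k 0 w ^+ q).

Definition in_Theta (m : nat) : Prop :=
  [/\ has_moment P (eps 0) m,
      forall k : 'I_p, has_moment P (eta k 0) (2 * m) &
      forall (k : 'I_p) (a : nat) (t : int), (a <= m)%N ->
        P.-integrable setT (fun w => (eta k t w ^+ a * X t w ^+ m)%:E)].

Definition observed (n : nat) (Y : T -> R) : Prop :=
  [\/ exists i : 'I_p, Y = X (- (i : nat)%:Z),
      exists (k : 'I_p) (t : nat), (t <= n)%N /\ Y = eta k t%:Z |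
      exists t : nat, (1 <= t <= n)%N /\ Y = eps t%:Z].

Definition Fstar (n : nat) : set (set T) :=
  <<s [set B | exists (Y : T -> R) (A : set R),
         [/\ observed n Y, measurable A & B = Y @^-1` A] ] >>.

Definition second_order_factor (dl dl' : nat) (k : 'I_p) (a : bool)
    (t : int) (w : T) : R :=
  X (t - dl%:Z) w * eta k (t - dl'%:Z) w ^+ a.

(* "Isolated" means not summed over the trajectory: the term is taken either
   at the current time t = n or at a fixed time. *)
Definition isolated_term (Z : nat -> T -> R) : Prop :=
  exists (c : R) (d1 d1' d2 d2' : nat) (k1 k2 : 'I_p) (a1 a2 : bool)
         (time : nat -> int),
    [/\ (d1' <= d1)%N, (d2' <= d2)%N,
        time = (fun n => n%:Z) \/ (exists t0 : int, time = fun=> t0) &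
        forall n w, Z n w = c * (second_order_factor d1 d1' k1 a1 (time n) w
                                 * second_order_factor d2 d2' k2 a2 (time n) w)].

Definition made_of_isolated_terms (Rn : nat -> T -> R) : Prop :=
  exists (r : nat) (Z : 'I_r -> nat -> T -> R),
    (forall i, isolated_term (Z i)) /\
    forall n w, Rn n w = \sum_(i < r) Z i n w.

Definition s0_model : R := s0 theta alpha (tau 2) (sigma 2).

Definition decomposition_vector (U : 'cV[R]_p) : Prop :=
  coord U p = 0 /\
  exists M' R' : nat -> T -> R,
    [/\ martingale P Fstar M',
        made_of_isolated_terms R' &
        forall n : nat, (0 < n)%N -> {ae P, forall w,
          \sum_(1 <= t < n.+1) X t%:Z w ^+ 2 =
            (U^T *m (\sum_(1 <= t < n.+1) X t%:Z w *: Phi (t%:Z - 1) w)) 0 0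
              / (1 - s0_model)
            + (ell 0 - (U^T *m L1) 0 0 / (1 - s0_model)) * n%:R
            + M' n w + R' n w}].

Definition in_Theta_star (U : 'cV[R]_p) : Prop :=
  let b1 := beta1 alpha (tau 2) in
  let K := Kmat theta alpha (tau 2) in
  Lambda0 \notin unitmx \/
  2 * b1 = 1 \/
  coord alpha 1 * b1 = 1 \/
  \det (1%:M - K) = 0 \/
  s0_model = 1 \/
  (U^T *m invmx (1%:M - K) *m U0 theta alpha (tau 2)) 0 0 = 1 - s0_model.

End Model.

Arguments theta_hat {d T R P} p X n w.
Arguments Lambda0 {d T R P} p X.
Arguments L1 {d T R P} p X.

(* Main.v *)
From HB Require Import structures.
Require Import Defs.
From mathcomp Require Import ring lra zify measurable_realfun.

Set Implicit Arguments.
Unset Strict Implicit.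
Unset Printing Implicit Defensive.
Import Order.TTheory GRing.Theory Num.Theory.
Local Open Scope classical_set_scope.
Local Open Scope ring_scope.

(** The estimator is a continuous function of the empirical second moments
    (1/n) sum_t X_(t-a) X_(t-b), so it suffices that each of them converges
    almost surely to the autocovariance of lag |a - b|.  The limiting matrix is
    invertible, hence so are the empirical ones for n large, and Cramer's rule
    passes to the limit ([cvg_solve]).

    The empirical moments are time averages along the shift of a trajectory of
    the innovations.  Two facts make them converge.

    First, under the law of an independent and identically distributed sequence
    indexed by the integers, the time averages of every integrable function f
    of the trajectory converge almost surely to the integral of f
    ([bernoulli_slln]).  The set of such f is closed in L^1 by Garsia's maximal
    inequality ([maximal_inequality], [slln_closed]) and contains the bounded
    coboundaries g - g o S, whose sums telescope.  The centred indicator of a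
    finite-dimensional cylinder is a coboundary plus the average of its
    translates along widely spaced times; these are pairwise independent, so
    that average is small in L^2 ([slln_indic_spaced]).  Dynkin's theorem then
    gives the indicators of all events, and simple functions give L^1.

    Second, X_t is almost surely a fixed measurable function of the innovations
    up to time t ([ae_causal]).  Running the state equation from 0 over m steps
    misses the state by a product of m random matrices applied to the state at
    time t - m.  By the first fact, applied backwards in time to an integrable
    majorant of the logarithm of the norm of those matrices
    ([exp_majorant]), the product decays exponentially; by stationarity,
    Chebyshev's inequality and the Borel-Cantelli lemma, the state at time t - m
    grows slower than any exponential ([eventually_exp_bounded]).

    Hence X_(t+i) X_t is F evaluated at the trajectory seen from time t, for a
    measurable F which is integrable because X is square integrable, and the
    first fact applies to F ([ae_autocovariance]). *)

(** * Elementary bounds and indicators *)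

Lemma natSinv_lt (R : realType) (e : R) : 0 < e -> exists k : nat, k.+1%:R^-1 < e.
Proof.
move=> e0; have [k _ /(_ k (leqnn k)) h] := near_infty_natSinv_lt (PosNum e0).
by exists k.
Qed.

Lemma normr_le_sqr (R : realFieldType) (y e : R) : 0 < e ->
  `|y| <= y ^+ 2 / (2 * e) + e / 2.
Proof.
move=> e0; rewrite -(real_normK (num_real y)); move: (`|y|) => a.
have -> : a ^+ 2 / (2 * e) + e / 2 = a + (a - e) ^+ 2 / (2 * e).
  by field; rewrite gt_eqF.
by rewrite lerDl divr_ge0 ?sqr_ge0// mulr_ge0// ltW.
Qed.

Lemma normrM_le_sqr (R : realFieldType) (x y : R) :
  `|x * y| <= 2^-1 * (x ^+ 2 + y ^+ 2).
Proof.
have h1 := sqr_ge0 (x + y); have h2 := sqr_ge0 (x - y).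
by rewrite ler_norml; apply/andP; split; nra.
Qed.

Lemma indic_bigsetU_trivIset (R : realType) (T : Type) (F : nat -> set T) n x :
  trivIset setT F ->
  \1_(\big[setU/set0]_(k < n) F k) x = \sum_(0 <= k < n) \1_(F k) x :> R.
Proof.
move=> tF; elim: n => [|n IH]; first by rewrite big_ord0 big_geq// indic0.
rewrite big_ord_recr big_nat_recr//= -IH !indicE in_setU.
have [xF|] := boolP (x \in F n); last by rewrite orbF addr0.
rewrite orbT; have [xG|] := boolP (x \in _); last by rewrite add0r.
have := @trivIset_bigsetUI _ xpredT F _ n n isT (leqnn n).
move=> /(_ (sub_trivIset (@subsetT _ _) tF))/seteqP[/(_ x)[]].
by split; apply/set_mem.
Qed.

Lemma measurable_superlevel d (T : measurableType d) (R : realType)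
    (f : T -> R) (a : R) :
  measurable_fun setT f -> measurable [set x | a < f x].
Proof.
move=> mf; rewrite [X in measurable X](_ : _ = setT `&` f @^-1` `]a, +oo[%classic).
  exact: mf.
by apply/seteqP; split => x /=; rewrite in_itv /= andbT => // -[].
Qed.

(** * Real integrals on a probability space *)

Section RealIntegrals.
Context {d : measure_display} {T : measurableType d} {R : realType}.
Variable Q : probability T R.

Local Notation integrable f := (Q.-integrable setT (EFin \o f)).

Lemma integrable_lincomb a b (f g : T -> R) : integrable f -> integrable g ->
  integrable (fun x => a * f x + b * g x).
Proof.
move=> fi gi.
have := integrableD measurableT (integrableZl measurableT a fi)
  (integrableZl measurableT b gi).
exact.
Qed.

Lemma integrable_Rcst a : integrable (fun=> a).
Proof. exact: (finite_measure_integrable_cst Q a measurableT). Qed.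

Lemma Rintegral_lincomb a b (f g : T -> R) : integrable f -> integrable g ->
  \int[Q]_x (a * f x + b * g x) = a * \int[Q]_x f x + b * \int[Q]_x g x.
Proof.
move=> fi gi; rewrite RintegralD//; last 2 first.
- exact: (integrableZl measurableT a fi).
- exact: (integrableZl measurableT b gi).
by rewrite !RintegralZl.
Qed.

Lemma bounded_integrable (g : T -> R) (M : R) : measurable_fun setT g ->
  (forall x, `|g x| <= M) -> integrable g.
Proof.
move=> mg gM; apply: measurable_bounded_integrable => //.
  by rewrite [X in (X < _)%E](@probability_setT _ _ _ Q) ltry.
exists M; split; first exact: num_real.
by move=> y My x _; rewrite /= (le_trans (gM x))// ltW.
Qed.

Lemma indic_integrable (A : set T) : measurable A -> integrable (\1_A : T -> R).
Proof.
move=> mA; apply: (bounded_integrable (M := 1)); first exact: measurable_indic.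
by move=> x; rewrite indicE; case: (x \in A); rewrite ?normr1 ?normr0.
Qed.

Lemma Rintegral_indic (A : set T) : measurable A ->
  \int[Q]_x (\1_A x) = fine (Q A).
Proof. by move=> mA; rewrite /Rintegral integral_indic// setIT. Qed.

Lemma integrable_Rsum (I : Type) (s : seq I) (f : I -> T -> R) :
  (forall i, integrable (f i)) -> integrable (fun x => \sum_(i <- s) f i x).
Proof.
move=> fi; elim: s => [|i s IH].
  rewrite (_ : (EFin \o _) = (EFin \o (fun=> 0))); first exact: integrable_Rcst.
  by apply/funext => x /=; rewrite big_nil.
rewrite (_ : (EFin \o _) = EFin \o (fun x => 1 * f i x + 1 * \sum_(j <- s) f j x)).
  exact: integrable_lincomb.
by apply/funext => x /=; rewrite big_cons !mul1r.
Qed.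

Lemma Rintegral_sum (I : Type) (s : seq I) (f : I -> T -> R) :
  (forall i, integrable (f i)) ->
  \int[Q]_x (\sum_(i <- s) f i x) = \sum_(i <- s) \int[Q]_x (f i x).
Proof.
move=> fi; elim: s => [|i s IH].
  by rewrite big_nil; under eq_Rintegral do rewrite big_nil; rewrite Rintegral_cst// mul0r.
rewrite big_cons -IH -RintegralD//; last exact: integrable_Rsum.
by apply: eq_Rintegral => x _; rewrite big_cons.
Qed.

End RealIntegrals.

(** * Measure-preserving maps and the maximal inequality *)

Section MaximalInequality.
Context {d : measure_display} {T : measurableType d} {R : realType}.
Variable Q : probability T R.

Definition measure_preserving (S : T -> T) : Prop :=
  measurable_fun setT S /\
  forall A, measurable A -> Q (S @^-1` A) = Q A.

Variable S : T -> T.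
Hypothesis preS : measure_preserving S.

Lemma ge0_integral_measure_preserving (f : T -> \bar R) :
  measurable_fun setT f -> (forall x, 0 <= f x)%E ->
  (\int[Q]_x f (S x) = \int[Q]_x f x)%E.
Proof.
move=> mf f0; case: preS => mS QS.
have /= <- := ge0_integral_pushforward mS Q (D := setT) (f := f) measurableT mf.
  by apply: eq_measure_integral => A mA _; exact: QS.
by move=> x _; exact: f0.
Qed.

Lemma integral_measure_preserving (f : T -> \bar R) : measurable_fun setT f ->
  (\int[Q]_x f (S x) = \int[Q]_x f x)%E.
Proof.
move=> mf; rewrite [LHS]integralE [RHS]integralE; congr (_ - _)%E.
  rewrite -(ge0_integral_measure_preserving (f := f^\+%E))//.
    by apply: eq_integral => x _; rewrite !funeposE.
  exact: measurable_funepos.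
rewrite -(ge0_integral_measure_preserving (f := f^\-%E))//.
  by apply: eq_integral => x _; rewrite !funenegE.
exact: measurable_funeneg.
Qed.

Lemma ae_measure_preserving (A : set T) :
  {ae Q, forall x, A x} -> {ae Q, forall x, A (S x)}.
Proof.
case: preS => mS QS [B [mB B0 AB]]; exists (S @^-1` B); split.
- by rewrite -[X in measurable X]setTI; exact: mS.
- by rewrite QS.
- by move=> x /= nA; exact: AB.
Qed.

Lemma measurable_iter k : measurable_fun setT (iter k S).
Proof.
case: preS => mS _; elim: k => [|k IH] /=; first exact: measurable_id.
exact: measurableT_comp.
Qed.

Variables (w : T -> R) (l : R).
Hypotheses (mw : measurable_fun setT w) (w0 : forall x, 0 <= w x).
Hypothesis iw : Q.-integrable setT (EFin \o w).
Hypothesis l0 : 0 < l.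

(** The largest of the partial sums of w - l along the first n points of the
    orbit of x, the empty sum included; the recursion isolates the first point,
    which is what the maximal inequality exploits. *)
Fixpoint walk_max (n : nat) (x : T) : R :=
  if n is m.+1 then Num.max 0 (w x - l + walk_max m (S x)) else 0.

Lemma walk_max_ge0 n x : 0 <= walk_max n x.
Proof. by case: n => [|n] //=; rewrite le_max lexx. Qed.

Lemma walk_max_ndS n x : walk_max n x <= walk_max n.+1 x.
Proof.
elim: n x => [|n IH] x; first by rewrite walk_max_ge0.
rewrite /= in IH *.
rewrite ge_max le_max lexx /= le_max; apply/orP; right.
by rewrite lerD2l; exact: IH.
Qed.

Lemma walk_max_sum n k x : (k <= n)%N ->
  \sum_(0 <= i < k) w (iter i S x) - l * k%:R <= walk_max n x.
Proof.
elim: n k x => [|n IH] [|k] x //.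
- by rewrite big_geq// mulr0 subrr.
- by move=> _; rewrite big_geq// mulr0 subrr walk_max_ge0.
- rewrite ltnS => kn; rewrite big_nat_recl//= le_max; apply/orP; right.
  have := IH k (S x) kn.
  have -> : \sum_(0 <= i < k) w (iter i S (S x)) = \sum_(0 <= i < k) w (S (iter i S x)).
    by apply: eq_bigr => i _; rewrite -iterSr.
  rewrite -natr1 /=; lra.
Qed.

Lemma measurable_walk_max n : measurable_fun setT (walk_max n).
Proof.
case: preS => mS _; elim: n => [|n IH] /=; first exact: measurable_cst.
apply: measurable_maxr; first exact: measurable_cst.
apply: measurable_funD; last exact: measurableT_comp.
by apply: measurable_funB => //; exact: measurable_cst.
Qed.

Lemma walk_max_fin_int n : (\int[Q]_x (walk_max n x)%:E < +oo)%E.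
Proof.
case: preS => mS _.
elim: n => [|n IH]; first by rewrite /= integral0.
have mwn := measurable_walk_max n.
apply: (@le_lt_trans _ _ (\int[Q]_x ((w x)%:E + (walk_max n (S x))%:E))%E).
  apply: ge0_le_integral => //.
  - by move=> x _; rewrite lee_fin walk_max_ge0.
  - by apply/measurable_EFinP/(measurable_walk_max n.+1).
  - apply: emeasurable_funD; apply/measurable_EFinP => //.
    exact: (measurableT_comp mwn).
  - move=> x _; rewrite -EFinD lee_fin /= ge_max addr_ge0 ?walk_max_ge0//=.
    by rewrite lerD2r gerBl ltW.
rewrite ge0_integralD//.
- rewrite (ge0_integral_measure_preserving (f := EFin \o walk_max n))//; last 2 first.
  + exact/measurable_EFinP.
  + by move=> x; rewrite lee_fin walk_max_ge0.
  rewrite lte_add_pinfty//.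
  case/integrableP: iw => _; apply: le_lt_trans.
  apply: ge0_le_integral => //.
  + by move=> x _; rewrite lee_fin.
  + exact/measurable_EFinP.
  + by apply: measurableT_comp => //; exact/measurable_EFinP.
  + by move=> x _; rewrite /= lee_fin ler_norm.
- by move=> x _; rewrite lee_fin.
- exact/measurable_EFinP.
- by move=> x _; rewrite lee_fin walk_max_ge0.
- by apply/measurable_EFinP; exact: (measurableT_comp mwn).
Qed.

Lemma measurable_walk_max_gt0 n : measurable [set x | 0 < walk_max n x].
Proof. exact/measurable_superlevel/measurable_walk_max. Qed.

(** Garsia's argument.  Where M_(n+1) > 0, the recursion reads
    M_(n+1) = w - l + M_n o S; elsewhere M_(n+1) = 0.  In both cases
    M_(n+1) + l 1_(M_(n+1) > 0) <= w + M_n o S.  Integrating, and using that S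
    preserves the integral of M_n <= M_(n+1), the maxima cancel. *)
Lemma walk_max_gt0_le n :
  (l%:E * Q [set x | (0 < walk_max n x)%R] <= \int[Q]_x (w x)%:E)%E.
Proof.
case: preS => mS _.
case: n => [|n].
  rewrite [X in Q X](_ : _ = set0); last first.
    by apply/seteqP; split => x //=; rewrite ltxx.
  by rewrite measure0 mule0 integral_ge0// => x _; rewrite lee_fin.
have mM := measurable_walk_max_gt0 n.+1.
set A := [set x | _] in mM *.
have mwn := measurable_walk_max n.
have mwS := measurable_walk_max n.+1.
have key : (\int[Q]_x ((walk_max n.+1 x)%:E + l%:E * (\1_A x)%:E) <=
            \int[Q]_x ((w x)%:E + (walk_max n (S x))%:E))%E.
  apply: ge0_le_integral => //.
  - move=> x _; rewrite -EFinM -EFinD lee_fin addr_ge0 ?walk_max_ge0 ?mulr_ge0 ?(ltW l0)//.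
  - apply: emeasurable_funD; first exact/measurable_EFinP.
    by apply/measurable_EFinP/measurable_funM; [exact: measurable_cst|exact: measurable_indic].
  - apply: emeasurable_funD; apply/measurable_EFinP => //.
    exact: (measurableT_comp mwn).
  - move=> x _; rewrite -EFinM -!EFinD lee_fin indicE.
    have [xA|xA] := boolP (x \in A).
      move: xA; rewrite inE /A /= lt_max ltxx /= mulr1 => h.
      by rewrite max_r ?(ltW h)//; lra.
    move: xA; rewrite notin_setE /A /=.
    move/negP; rewrite -leNgt => h.
    rewrite mulr0 addr0 (le_trans h)// addr_ge0 ?walk_max_ge0//.
have I0 : (\int[Q]_x (walk_max n.+1 x)%:E \is a fin_num)%E.
  rewrite ge0_fin_numE ?walk_max_fin_int// integral_ge0// => x _.
  by rewrite lee_fin walk_max_ge0.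
rewrite ge0_integralD// in key; first last.
- apply/measurable_EFinP/measurable_funM; [exact: measurable_cst|exact: measurable_indic].
- by move=> x _; rewrite -EFinM lee_fin mulr_ge0 ?(ltW l0)// indicE.
- exact/measurable_EFinP.
- by move=> x _; rewrite lee_fin walk_max_ge0.
rewrite ge0_integralZl_EFin// in key; first last.
- exact: ltW.
- by apply/measurable_EFinP; exact: measurable_indic.
rewrite integral_indic// setIT in key.
rewrite ge0_integralD// in key; first last.
- by apply/measurable_EFinP; exact: (measurableT_comp mwn).
- by move=> x _; rewrite lee_fin walk_max_ge0.
- exact/measurable_EFinP.
- by move=> x _; rewrite lee_fin.
rewrite (ge0_integral_measure_preserving (f := EFin \o walk_max n))// in key; first last.
- by move=> x; rewrite lee_fin walk_max_ge0.
- exact/measurable_EFinP.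
have le : (\int[Q]_x (EFin \o walk_max n) x <= \int[Q]_x (walk_max n.+1 x)%:E)%E.
  apply: ge0_le_integral => //.
  - by move=> x _; rewrite lee_fin walk_max_ge0.
  - exact/measurable_EFinP.
  - exact/measurable_EFinP.
  - by move=> x _; rewrite lee_fin; exact: walk_max_ndS.
rewrite -(leeD2lE _ _ I0); apply: (le_trans key).
by rewrite addeC; apply: leeD.
Qed.

(** The event that some time average of w exceeds l has measure at most the
    integral of w divided by l: it is the increasing union of the events
    0 < walk_max n. *)
Lemma maximal_inequality :
  exists U : set T, [/\ measurable U,
    forall x k, l * k%:R < \sum_(0 <= i < k) w (iter i S x) -> U x &
    (l%:E * Q U <= \int[Q]_x (w x)%:E)%E].
Proof.
pose F n := [set x | 0 < walk_max n x].
exists (\bigcup_n F n); split.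
- by apply: bigcup_measurable => n _; exact: measurable_walk_max_gt0.
- move=> x k h; exists k => //; rewrite /F /=.
  by apply: lt_le_trans (walk_max_sum x (leqnn k)); rewrite subr_gt0.
- have ndF : nondecreasing_seq F.
    apply/nondecreasing_seqP => n; apply/subsetPset => x; rewrite /F /= => h.
    exact: lt_le_trans h (walk_max_ndS n x).
  have mF n : measurable (F n) by exact: measurable_walk_max_gt0.
  have := nondecreasing_cvg_mu (mu := Q) mF (bigcup_measurable (fun n _ => mF n)) ndF.
  move=> /(cvgeZl (y := l%:E)) => /(_ erefl) cv.
  rewrite -(cvg_lim _ cv)//; apply: lime_le; first by apply/cvg_ex; eexists; exact: cv.
  by apply: nearW => n; exact: walk_max_gt0_le.
Qed.
End MaximalInequality.

(** * Functions obeying the strong law of large numbers *)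

Section TimeMeans.
Context {d : measure_display} {T : measurableType d} {R : realType}.
Variables (Q : probability T R) (S : T -> T).
Hypothesis preS : measure_preserving Q S.

Local Notation integrable f := (Q.-integrable setT (EFin \o f)).

Definition time_mean (f : T -> R) (n : nat) (x : T) : R :=
  n%:R^-1 * \sum_(0 <= k < n) f (iter k S x).

Definition slln (f : T -> R) : Prop :=
  integrable f /\
  {ae Q, forall x, time_mean f n x @[n --> \oo] --> \int[Q]_x f x}.

Lemma integrable_comp_preserving (f : T -> R) :
  integrable f -> integrable (f \o S).
Proof.
case: preS => mS _ /integrableP[mf fi]; apply/integrableP; split.
  exact: (measurableT_comp mf mS).
rewrite /=.
rewrite (ge0_integral_measure_preserving preS (f := fun x => `|(EFin \o f) x|%E))//.
exact: measurableT_comp.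
Qed.

Lemma Rintegral_comp_preserving (f : T -> R) :
  integrable f -> \int[Q]_x f (S x) = \int[Q]_x f x.
Proof.
move=> fi; congr fine.
exact: (integral_measure_preserving preS (measurable_int _ fi)).
Qed.

Lemma time_mean_lincomb a b f g n x :
  time_mean (fun x => a * f x + b * g x) n x =
  a * time_mean f n x + b * time_mean g n x.
Proof.
rewrite /time_mean big_split /= -!mulr_sumr mulrDr.
by congr (_ + _); rewrite mulrCA.
Qed.

Lemma slln_lincomb a b f g : slln f -> slln g ->
  slln (fun x => a * f x + b * g x).
Proof.
move=> [fi fc] [gi gc]; split; first exact: integrable_lincomb.
rewrite Rintegral_lincomb//.
apply: filterS2 fc gc => x fx gx.
rewrite (_ : (fun n => _) = (fun n => a * time_mean f n x + b * time_mean g n x)).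
  by apply: cvgD; apply: cvgMr.
by apply/funext => n; rewrite time_mean_lincomb.
Qed.

Lemma slln_cst a : slln (fun=> a).
Proof.
split; first exact: integrable_Rcst.
have QT : fine (Q setT) = 1 by rewrite probability_setT.
apply: aeW => x; rewrite Rintegral_cst// [X in _ * X]QT mulr1.
apply: cvg_near_cst; exists 1%N => // n /= n0.
rewrite /time_mean sumr_const_nat subn0 -[a *+ n]mulr_natl mulrA mulVf ?mul1r//.
by rewrite pnatr_eq0 -lt0n.
Qed.

Lemma slln_sum (I : Type) (s : seq I) (f : I -> T -> R) :
  (forall i, slln (f i)) -> slln (fun x => \sum_(i <- s) f i x).
Proof.
move=> fe; elim: s => [|i s IH].
  rewrite (_ : (fun x => _) = (fun=> 0)); first exact: slln_cst.
  by apply/funext => x; rewrite big_nil.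
rewrite (_ : (fun x => _) = (fun x => 1 * f i x + 1 * \sum_(j <- s) f j x)).
  exact: slln_lincomb.
by apply/funext => x; rewrite big_cons !mul1r.
Qed.

(** The sums telescope: they stay bounded, and dividing by n kills them. *)
Lemma slln_coboundary (g : T -> R) (M : R) : measurable_fun setT g ->
  (forall x, `|g x| <= M) -> slln (fun x => g x - g (S x)).
Proof.
move=> mg gM.
have gi := bounded_integrable Q mg gM.
have gSi := integrable_comp_preserving gi.
split.
  have := integrableB measurableT gi gSi; exact.
rewrite RintegralB// Rintegral_comp_preserving// subrr.
apply: aeW => x.
have E n : time_mean (fun x => g x - g (S x)) n x = n%:R^-1 * (g x - g (iter n S x)).
  rewrite /time_mean; congr (_ * _); rewrite -opprB.
  have -> : g (iter n S x) - g x =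
      \sum_(0 <= i < n) (g (iter i.+1 S x) - g (iter i S x)).
    by rewrite (telescope_sumr (fun i => g (iter i S x))).
  rewrite -sumrN.
  by apply: eq_bigr => i _; rewrite opprB.
apply/cvgrPdist_le => e e0.
have M0 : 0 <= M by exact: le_trans (gM x).
near=> n.
rewrite sub0r normrN E normrM normfV (@ger0_norm _ n%:R)//.
have n0 : 0 < n%:R :> R by near: n; exists 1%N => //= n; rewrite ltr0n.
rewrite ler_pdivrMl//; apply: (@le_trans _ _ (2 * M)).
  by rewrite (le_trans (ler_normB _ _))// mulr2n mulrDl mul1r lerD.
rewrite -ler_pdivrMr//; near: n.
exact: nbhs_infty_ger.
Unshelve. all: by end_near. Qed.

Lemma time_mean_dist f h n x l : 0 <= l ->
  \sum_(0 <= k < n) `|f (iter k S x) - h (iter k S x)| <= l * n%:R ->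
  `|time_mean f n x - time_mean h n x| <= l.
Proof.
move=> l0 H; rewrite /time_mean -mulrBr -sumrB normrM ger0_norm ?invr_ge0//.
case: n H => [|n] H; first by rewrite invr0 mul0r.
rewrite ler_pdivrMl ?ltr0n// mulrC; apply: le_trans H.
exact: ler_norm_sum.
Qed.

(** If h_j tends to f in L^1, the maximal inequality applied to |f - h_j| shows
    that, off a set of small measure, all time averages of f and h_j are
    uniformly close.  For each precision 1/(k+1), the points where this fails
    for every j >= k form a null set N k. *)
Lemma slln_closed (f : T -> R) : integrable f ->
  (forall e, 0 < e ->
     exists2 h, slln h & \int[Q]_x `|f x - h x| <= e) ->
  slln f.
Proof.
move=> fi approx; split => //.
have /choice[h hP] : forall j : nat, exists h, slln h /\
    \int[Q]_x `|f x - h x| <= j.+1%:R^-1.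
  move=> j; have [|h h1 h2] := approx j.+1%:R^-1; first by rewrite invr_gt0.
  by exists h.
have wi j : integrable (fun x => `|f x - h j x|).
  have [[hi _] _] := hP j.
  have := integrable_norm (f := fun x => f x - h j x)
    (integrableB measurableT fi hi).
  exact.
have wE j : (\int[Q]_x (`|f x - h j x|%:E) <= (j.+1%:R^-1)%:E)%E.
  have [_ H] := hP j; rewrite -[leLHS]fineK ?lee_fin//.
  exact: (integrable_fin_num measurableT (wi j)).
have /choice[U UP] : forall kj : nat * nat, exists U : set T, [/\ measurable U,
    forall x n, kj.1.+1%:R^-1 * n%:R <
      \sum_(0 <= i < n) `|f (iter i S x) - h kj.2 (iter i S x)| -> U x &
    ((kj.1.+1%:R^-1 : R)%:E * Q U <= (kj.2.+1%:R^-1)%:E)%E].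
  move=> [k j] /=.
  have mw : measurable_fun setT (fun x => `|f x - h j x|).
    exact/measurable_EFinP/(measurable_int _ (wi j)).
  have w0 x : 0 <= `|f x - h j x| by [].
  have l0 : 0 < k.+1%:R^-1 :> R by rewrite invr_gt0.
  have [U [mU H1 H2]] := maximal_inequality preS mw w0 (wi j) l0.
  by exists U; split => //; exact: le_trans H2 (wE j).
pose N k := \bigcap_(j in [set j | (k <= j)%N]) U (k, j).
have mN k : measurable (N k).
  by apply: bigcap_measurable => [|j _]; [exists k => /= | have [] := UP (k, j)].
have N0 k : Q (N k) = 0%E.
  apply/eqP; rewrite eq_le measure_ge0 andbT.
  rewrite -[Q (N k)]fineK ?fin_num_measure// lee_fin.
  apply/ler_addgt0Pr => e e0; rewrite add0r.
  have [|j0 j0e] := @natSinv_lt R (e / k.+1%:R); first by rewrite divr_gt0.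
  (* j must belong to the intersection defining N k and make 1/(j+1) small
     compared with e/(k+1). *)
  pose j := maxn k j0.
  have [mU _ HU] := UP (k, j).
  have NU : (Q (N k) <= Q (U (k, j)))%E.
    rewrite le_measure ?inE//; apply: bigcap_inf; rewrite /= leq_max leqnn//.
  have : ((k.+1%:R^-1 : R)%:E * Q (N k) <= (j.+1%:R^-1)%:E)%E.
    by apply: le_trans HU; rewrite lee_pmul2l//= lte_fin invr_gt0.
  rewrite -[Q (N k)]fineK ?fin_num_measure// -EFinM lee_fin.
  rewrite ler_pdivrMl// => /le_trans; apply.
  rewrite mulrC -ler_pdivlMr//; apply: le_trans (ltW j0e).
  by rewrite lef_pV2 ?posrE// ler_nat ltnS leq_max leqnn orbT.
have aeN : {ae Q, forall x, forall k, ~ N k x}.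
  apply: ae_foralln => k; exists (N k); split => //; first exact: N0.
  by move=> x /= /contrapT.
have aeh : {ae Q, forall x, forall j,
    time_mean (h j) n x @[n --> \oo] --> \int[Q]_x h j x}.
  by apply: ae_foralln => j; have [[]] := hP j.
apply: filterS2 aeN aeh => x Nx hx.
apply/cvgrPdist_le => e e0.
have [|k ke] := @natSinv_lt R (e / 3); first by rewrite divr_gt0.
have /existsNP[j /not_implyP[/= kj Ux]] := Nx k.
have [_ Uin _] := UP (k, j).
have D n : `|time_mean f n x - time_mean (h j) n x| <= e / 3.
  apply: (le_trans _ (ltW ke)); apply: time_mean_dist => //.
  rewrite leNgt; apply/negP => /(Uin x n); exact: Ux.
have D' : `|\int[Q]_x f x - \int[Q]_x h j x| <= e / 3.
  have [[hi _] H] := hP j.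
  rewrite -RintegralB//; apply: (le_trans (le_normr_Rintegral _ _)) => //.
    have := integrableB measurableT fi hi; exact.
  apply: (le_trans H); apply: (le_trans _ (ltW ke)).
  by rewrite lef_pV2 ?posrE// ler_nat ltnS.
have e3 : 0 < e / 3 by rewrite divr_gt0.
have /cvgrPdist_le/(_ _ e3) := hx j.
apply: filterS => n Hn.
have := D n; rewrite distrC; move: D' Hn.
move: (\int[Q]_x f x) (\int[Q]_x h j x) (time_mean f n x)
  (time_mean (h j) n x) => a b c c' ab bc' cc'.
have -> : a - c = (a - b) + ((b - c') + (c' - c)) by ring.
have -> : e = e / 3 + (e / 3 + e / 3) by field.
by do 2 (rewrite (le_trans (ler_normD _ _))// lerD//).
Qed.

End TimeMeans.

(** * From a generating class of events to all integrable functions *)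

Section SllnIndicators.
Context {d : measure_display} {T : measurableType d} {R : realType}.
Variables (Q : probability T R) (S : T -> T).
Hypothesis preS : measure_preserving Q S.

Local Notation integrable f := (Q.-integrable setT (EFin \o f)).

(** Expanding the square, pairwise independence leaves only the n diagonal
    terms q - q^2 <= 1. *)
Lemma pairwise_independent_variance (B : nat -> set T) (q : R) (n : nat) :
  (forall k, measurable (B k)) ->
  (forall k, Q (B k) = q%:E) ->
  (forall j k, j != k -> Q (B j `&` B k) = (q * q)%:E) ->
  \int[Q]_x ((\sum_(0 <= k < n) (\1_(B k) x - q)) ^+ 2) <= n%:R.
Proof.
move=> mB QB QBB.
have q01 : 0 <= q <= 1.
  by rewrite -!lee_fin -(QB 0%N) measure_ge0 probability_le1.
pose u j k x : R := 1 * (1 * \1_(B j `&` B k) x + (- q) * \1_(B j) x)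
  + 1 * ((- q) * \1_(B k) x + q ^+ 2 * 1).
have ui j k : integrable (u j k).
  by do !apply: integrable_lincomb;
    try (apply: indic_integrable; rewrite //; exact: measurableI);
    exact: integrable_Rcst.
have E x : (\sum_(0 <= k < n) (\1_(B k) x - q)) ^+ 2 =
    \sum_(0 <= j < n) \sum_(0 <= k < n) u j k x.
  rewrite expr2 mulr_suml; apply: eq_bigr => j _.
  rewrite mulr_sumr; apply: eq_bigr => k _.
  by rewrite /u indicI /=; ring.
under eq_Rintegral do rewrite E.
rewrite Rintegral_sum; last by move=> j; exact: integrable_Rsum.
have U j k : \int[Q]_x u j k x = if j == k then q - q ^+ 2 else 0.
  have i1 := indic_integrable Q (measurableI _ _ (mB j) (mB k)).
  have i2 := indic_integrable Q (mB j).
  have i3 := indic_integrable Q (mB k).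
  have i4 := integrable_Rcst Q 1.
  rewrite !Rintegral_lincomb//; try exact: integrable_lincomb.
  rewrite !Rintegral_indic//; last exact: measurableI.
  rewrite Rintegral_cst// [fine (Q setT)](_ : _ = 1); last by rewrite probability_setT.
  rewrite !QB; case: eqVneq => [->|jk].
    by rewrite setIid QB/=; ring.
  by rewrite QBB//=; ring.
under eq_bigr => j _ do rewrite Rintegral_sum//.
apply: (@le_trans _ _ (\sum_(0 <= j < n) 1)); last first.
  by rewrite sumr_const_nat subn0.
rewrite big_nat_cond [leRHS]big_nat_cond.
apply: ler_sum => j /andP[/andP[_ jn] _].
under eq_bigr => k _ do rewrite U.
rewrite (bigD1_seq j) ?mem_index_iota ?iota_uniq//= eqxx big1 ?addr0.
  by move: q01 => /andP[]; nra.
by move=> k kj; rewrite eq_sym (negbTE kj).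
Qed.

Lemma slln_coboundary_iter (f : T -> R) (M : R) m : measurable_fun setT f ->
  (forall x, `|f x| <= M) -> slln Q S (fun x => f x - f (iter m S x)).
Proof.
move=> mf fM.
rewrite (_ : (fun x => _) = (fun x => \sum_(j <- iota 0 m)
    (f (iter j S x) - f (iter j S (S x))))).
  apply: slln_sum => // j.
  apply: (slln_coboundary preS (g := fun x => f (iter j S x)) (M := M)) => //.
  exact: (measurableT_comp mf (measurable_iter preS j)).
apply/funext => x.
rewrite -[iota 0 m](_ : index_iota 0 m = _); last by rewrite /index_iota subn0.
have -> : f x - f (iter m S x) =
    - \sum_(0 <= i < m) (f (iter i.+1 S x) - f (iter i S x)).
  by rewrite (telescope_sumr (fun i => f (iter i S x)))// opprB.
rewrite -sumrN; by apply: eq_bigr => i _; rewrite opprB -iterSr.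
Qed.

(** The indicator of B minus the mean of its translates at the times
    t 0, ..., t n is a combination of coboundaries.  What remains is that mean,
    whose distance to the constant Q B is small in L^2, hence in L^1, because
    the translates are pairwise independent. *)
Lemma slln_indic_spaced (B : set T) (t : nat -> nat) : measurable B ->
  (forall j k, j != k ->
     Q (iter (t j) S @^-1` B `&` iter (t k) S @^-1` B) = (Q B * Q B)%E) ->
  slln Q S (\1_B).
Proof.
move=> mB QBB.
have QBf : Q B = (fine (Q B))%:E by rewrite fineK// fin_num_measure.
set q := fine (Q B) in QBf.
pose Bk k := iter (t k) S @^-1` B.
have mBk k : measurable (Bk k).
  by rewrite /Bk -[X in measurable X]setTI; exact: (measurable_iter preS).
have QBk k : Q (Bk k) = q%:E.
  rewrite /Bk -QBf; elim: (t k) => [//|m IH].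
  rewrite -IH; case: preS => mS QS.
  rewrite -(QS (iter m S @^-1` B)).
    by congr (Q _); apply/seteqP; split => x /=; rewrite -iterS iterSr.
  by rewrite -[X in measurable X]setTI; exact: (measurable_iter preS).
apply: slln_closed => //; first exact: indic_integrable.
move=> e e0.
have e20 : 0 < e ^+ 2 by rewrite exprn_gt0.
have [n ne] := natSinv_lt e20.
have n0 : 0 < n.+1%:R :> R by rewrite ltr0n.
pose Z x : R := \sum_(0 <= k < n.+1) (\1_(Bk k) x - q).
exists (fun x => n.+1%:R^-1 *
    \sum_(k <- iota 0 n.+1) (\1_B x - \1_B (iter (t k) S x)) + 1 * q).
  apply: slln_lincomb; last exact: slln_cst.
  apply: slln_sum => k.
  apply: (@slln_coboundary_iter _ 1); first exact: measurable_indic.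
  by move=> x; rewrite indicE; case: (x \in B); rewrite ?normr1 ?normr0.
have E x : \1_B x - (n.+1%:R^-1 *
    \sum_(k <- iota 0 n.+1) (\1_B x - \1_B (iter (t k) S x)) + 1 * q) =
    n.+1%:R^-1 * Z x.
  rewrite /Z -[iota 0 n.+1](_ : index_iota 0 n.+1 = _); last by rewrite /index_iota subn0.
  rewrite !sumrB !sumr_const_nat subn0 -[\1_B x *+ _]mulr_natl -[q *+ _]mulr_natl.
  rewrite (_ : \sum_(0 <= k < n.+1) \1_B (iter (t k) S x) =
               \sum_(0 <= k < n.+1) \1_(Bk k) x)//.
  by field; rewrite nat1r pnatr_eq0.
under eq_Rintegral do rewrite E.
have Zi : integrable Z.
  apply: integrable_Rsum => k.
  rewrite (_ : (EFin \o _) = EFin \o (fun x => 1 * \1_(Bk k) x + (- 1) * q)).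
    by apply: integrable_lincomb; [exact: indic_integrable|exact: integrable_Rcst].
  by apply/funext => x /=; rewrite mul1r mulN1r.
have mZ : measurable_fun setT Z by exact/measurable_EFinP/(measurable_int _ Zi).
have Zb x : `|Z x| <= \sum_(0 <= k < n.+1) (1 + `|q|).
  apply: (le_trans (ler_norm_sum _ _ _)); apply: ler_sum => k _.
  rewrite (le_trans (ler_normB _ _))// lerD2r indicE.
  by case: (x \in _); rewrite ?normr1 ?normr0.
have Z2i : integrable (fun x => Z x ^+ 2).
  apply: (bounded_integrable Q
      (M := (\sum_(0 <= k < n.+1) (1 + `|q|)) ^+ 2)).
    exact: measurable_funX.
  move=> x; rewrite normrX lerXn2r ?nnegrE//.
  by apply: sumr_ge0 => k _; rewrite addr_ge0.
have V : \int[Q]_x (Z x ^+ 2) <= n.+1%:R.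
  apply: pairwise_independent_variance => // j k jk.
  by rewrite QBB// QBf EFinM.
(* c Z^2 is y^2 / (2e) for y = Z / (n+1), so that |y| <= c Z^2 + e/2. *)
pose c := (2 * e * n.+1%:R ^+ 2)^-1.
apply: (@le_trans _ _ (\int[Q]_x (c * Z x ^+ 2 + (e / 2) * 1))).
  apply: le_Rintegral => //.
  - apply: (integrable_norm (f := fun x => n.+1%:R^-1 * Z x)).
    exact: (integrableZl measurableT _ Zi).
  - by apply: integrable_lincomb => //; exact: integrable_Rcst.
  move=> x _.
  set y := n.+1%:R^-1 * Z x.
  have -> : c * Z x ^+ 2 = y ^+ 2 / (2 * e).
    rewrite /y /c; move: (n.+1%:R : R) n0 => N N0.
    by field; rewrite !gt_eqF.
  by rewrite mulr1; exact: normr_le_sqr.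
rewrite Rintegral_lincomb//; last exact: integrable_Rcst.
rewrite Rintegral_cst// [fine (Q setT)](_ : _ = 1); last by rewrite probability_setT.
have c0 : 0 <= c by rewrite invr_ge0 mulr_ge0// ?exprn_ge0// mulr_ge0// ltW.
apply: (@le_trans _ _ (c * n.+1%:R + e / 2 * (1 * 1))).
  by rewrite lerD2r ler_wpM2l.
have -> : c * n.+1%:R = n.+1%:R^-1 / (2 * e).
  rewrite /c; move: (n.+1%:R : R) n0 => N N0.
  by field; rewrite !gt_eqF.
have : n.+1%:R^-1 / (2 * e) <= e ^+ 2 / (2 * e).
  by rewrite ler_pM2r ?invr_gt0 ?mulr_gt0// ltW.
have -> : e ^+ 2 / (2 * e) = e / 2 by field; rewrite gt_eqF.
by move=> ze; rewrite !mulr1 [leRHS]splitr lerD2r.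
Qed.

(** Events whose indicator obeys the law form a Dynkin system: linearity gives
    complements, and closedness in L^1 gives countable disjoint unions. *)
Lemma slln_indic_dynkin (G : set (set T)) :
  @measurable _ T = <<s G >> -> setI_closed G ->
  (forall B, G B -> slln Q S (\1_B)) ->
  forall B, measurable B -> slln Q S (\1_B).
Proof.
move=> GE GI GB B; rewrite GE; move: B.
apply: (@dynkin_induction _ _ _ (fun B => slln Q S (\1_B))) => //.
- by rewrite indicT; exact: slln_cst.
- move=> B mB eB.
  rewrite (_ : \1_(~` B) = fun x => 1 * 1 + (-1) * \1_B x).
    by apply: slln_lincomb => //; exact: slln_cst.
  by apply/funext => x; rewrite !indicE in_setC; case: (x \in B) => /=; ring.
- move=> F mF tF eF.
  have mU : measurable (\bigcup_k F k) by exact: bigcup_measurable.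
  apply: slln_closed => //; first exact: indic_integrable.
  move=> e e0.
  pose G' n := \big[setU/set0]_(k < n.+1) F k.
  have mG' n : measurable (G' n) by exact: bigsetU_measurable.
  have GU n : G' n `<=` \bigcup_k F k by exact: bigsetU_bigcup.
  have cv : Q (G' n) @[n --> \oo] --> Q (\bigcup_k F k).
    rewrite -bigcup_bigsetU_bigcup; apply: nondecreasing_cvg_mu => //.
      by rewrite bigcup_bigsetU_bigcup.
    by move=> m n mn; exact/subsetPset/subset_bigsetU.
  have /fine_cvgP[_ /cvgrPdist_le/(_ _ e0)[n _ /(_ n (leqnn n))]] :
      Q (G' n) @[n --> \oo] --> (fine (Q (\bigcup_k F k)))%:E.
    by rewrite fineK// fin_num_measure.
  move=> He; exists (\1_(G' n)).
    rewrite (_ : \1_(G' n) = fun x => \sum_(k <- index_iota 0 n.+1) \1_(F k) x).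
      by apply: slln_sum.
    by apply/funext => x; rewrite indic_bigsetU_trivIset.
  have D x : `|\1_(\bigcup_k F k) x - \1_(G' n) x| =
      1 * \1_(\bigcup_k F k) x + (-1) * \1_(G' n) x :> R.
    rewrite mul1r mulN1r !indicE.
    have [xG|xG] := boolP (x \in G' n).
      have -> : x \in \bigcup_k F k by apply: mem_set; apply: (GU n); exact: set_mem.
      by rewrite subrr normr0.
    by rewrite subr0; case: (x \in _); rewrite ?normr1 ?normr0.
  under eq_Rintegral do rewrite D.
  rewrite Rintegral_lincomb; [|exact: indic_integrable..].
  rewrite !Rintegral_indic// mul1r mulN1r (le_trans _ He)// ler_norm//.
Qed.

Import HBSimple.

Lemma slln_of_indic (f : T -> R) :
  (forall B, measurable B -> slln Q S (\1_B)) ->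
  integrable f -> slln Q S f.
Proof.
move=> eB fi; apply: slln_closed => // e e0.
have [g [gi _ gcv]] := approximation_sfun_integrable measurableT fi.
have /fine_cvgP[gfin /cvgrPdist_le/(_ _ e0)[n _ /(_ n (leqnn n))]] :
  (\int[Q]_z `|(EFin \o f) z - (g n z)%:E|)%E @[n --> \oo] --> (0:R)%:E by [].
rewrite sub0r normrN /= => H.
exists (g n); last exact: (le_trans (ler_norm _) H).
rewrite (_ : (g n : T -> R) = fun x =>
    \sum_(y <- finmap.enum_fset (fset_set (range (g n))))
      (y * \1_(g n @^-1` [set y]) x + 0 * 0)).
  apply: slln_sum => y; apply: slln_lincomb; last exact: slln_cst.
  by apply: eB; exact: measurable_funPTI.
apply/funext => x; rewrite fimfunE fsbig_finite//=.
by apply: eq_bigr => y _; rewrite mul0r addr0.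
Qed.

End SllnIndicators.

(** * The shift on trajectories of an independent sequence *)

Definition mfun_of d1 d2 (T1 : measurableType d1) (T2 : measurableType d2)
    (f : T1 -> T2) (mf : measurable_fun setT f) : {mfun T1 >-> T2} :=
  HB.pack f (isMeasurableFun.Build _ _ _ _ _ mf).

Section BernoulliShift.
Context {d : measure_display} {E : measurableType d}.

Definition cylinder (s : seq int) (A : int -> set E) : set (int -> E) :=
  [set x | forall i, i \in s -> A i (x i)].

Definition cylinders : set (set (int -> E)) :=
  [set B | exists (s : seq int) (A : int -> set E),
     [/\ uniq s, forall i, measurable (A i) & B = cylinder s A]].

(** The product sigma-algebra on two-sided sequences, presented by the
    pi-system of finite-dimensional cylinders, on which independence determines
    the law. *)
Definition path_space := g_sigma_algebraType cylinders.

Definition shift (h : int) (x : path_space) : path_space := fun i => x (i + h).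

Lemma cylinders_setI : setI_closed cylinders.
Proof.
move=> _ _ [s [A [us mA ->]]] [t [B [ut mB ->]]].
exists (undup (s ++ t)), (fun i => (if i \in s then A i else setT) `&`
  (if i \in t then B i else setT)); split.
- exact: undup_uniq.
- by move=> i; apply: measurableI; case: ifP.
- apply/seteqP; split => x /=.
    move=> [H1 H2] i; rewrite mem_undup mem_cat => _; split.
      by case: ifP => // /H1.
    by case: ifP => // /H2.
  move=> H; split => i is_; have := H i; rewrite mem_undup mem_cat is_ ?orbT => /(_ isT)[].
    by [].
  by [].
Qed.

Lemma cylinder_nil : cylinders setT.
Proof.
exists [::], (fun=> setT); split => //.
by apply/seteqP; split.
Qed.

Lemma shift_cylinder h s A :
  shift h @^-1` cylinder s A = cylinder (map (+%R^~ h) s) (fun i => A (i - h)).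
Proof.
apply/seteqP; split => x /= H i.
  by move=> /mapP[j js ->]; rewrite addrK; exact: H.
by move=> is_; have := H (i + h); rewrite addrK; apply; exact: map_f.
Qed.

Lemma measurable_to_path d' (T : measurableType d') (f : T -> path_space) :
  (forall i, measurable_fun setT (fun w => f w i)) -> measurable_fun setT f.
Proof.
move=> mf; apply: (@measurability _ _ _ _ setT f cylinders) => //.
move=> _ [_ [s [A [us mA ->]]] <-]; rewrite setTI.
rewrite (_ : _ @^-1` _ = \big[setI/setT]_(i <- s) ((fun w => f w i) @^-1` A i)).
  by apply: bigsetI_measurable => i _; rewrite -[X in measurable X]setTI; exact: mf.
rewrite -bigcap_seq; apply/seteqP; split => x /= H i /=; exact: H.
Qed.

Lemma measurable_coord i : measurable_fun setT (fun x : path_space => x i).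
Proof.
move=> _ A mA; rewrite setTI; apply: sub_sigma_algebra.
exists [:: i], (fun=> A); split => //.
apply/seteqP; split => x /= H.
  by move=> j; rewrite inE => /eqP ->.
by apply: H; rewrite inE.
Qed.

Lemma measurable_shift h : measurable_fun setT (shift h).
Proof. by apply: measurable_to_path => i; exact: measurable_coord. Qed.

Lemma iter_shift n h x : iter n (shift h) x = shift (h *+ n) x.
Proof.
elim: n => [|n IH]; first by apply/funext => i; rewrite /shift mulr0n addr0.
by rewrite iterS IH; apply/funext => i; rewrite /shift mulrS addrA.
Qed.

Context {R : realType}.
Variables (Q : probability path_space R) (q : set E -> \bar R).
Hypothesis Qcyl : forall s A, uniq s -> (forall i, measurable (A i)) ->
  Q (cylinder s A) = (\prod_(i <- s) q (A i))%E.

(** Shifting a cylinder relabels its coordinates and leaves its product of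
    marginals unchanged; a law is determined by its values on cylinders. *)
Lemma shift_measure_preserving h : measure_preserving Q (shift h).
Proof.
split; first exact: measurable_shift.
move=> B mB.
have mS := measurable_shift h.
change (distribution Q (mfun_of mS) B = Q B).
apply: (@measure_unique _ _ path_space cylinders (fun=> setT) _ _ _ _
  (distribution Q (mfun_of mS)) Q) => //.
- exact: cylinders_setI.
- by move=> _; exact: cylinder_nil.
- by rewrite bigcup_const//; exists 0%N.
- move=> _ [s [A [us mA ->]]].
  change (Q (shift h @^-1` cylinder s A) = Q (cylinder s A)).
  rewrite shift_cylinder !Qcyl//.
    by rewrite big_map; apply: eq_bigr => i _; rewrite addrK.
  by rewrite map_inj_uniq//; exact: addIr.
- move=> _.
  rewrite [X in (X < _)%E](@probability_setT _ _ _ (distribution Q (mfun_of mS))).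
  exact: ltry.
Qed.

(** The translates of a cylinder along a sufficiently sparse arithmetic
    progression of times involve disjoint sets of coordinates, so they are
    independent.  Both directions of time serve: h = 1 for the averages of the
    process, h = -1 for the matrix products reaching into the past. *)
Lemma bernoulli_slln (h : int) (f : path_space -> R) : h != 0 ->
  Q.-integrable setT (EFin \o f) -> slln Q (shift h) f.
Proof.
move=> h0 fi; have pres := shift_measure_preserving h.
apply: slln_of_indic => //.
apply: (@slln_indic_dynkin _ _ _ _ _ pres cylinders) => //.
  exact: cylinders_setI.
move=> B [s [A [us mA ->]]].
(* A spacing larger than the distance between any two coordinates in s. *)
pose l := (2 * \sum_(i <- s) `|i|%N).+1.
have small i j : i \in s -> j \in s -> (`|i - j| < l)%N.
  move=> is_ js; rewrite /l ltnS mul2n -addnn.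
  apply: (@leq_trans (`|i| + `|j|)%N); first by lia.
  have le_sum a : a \in s -> (`|a| <= \sum_(i <- s) `|i|)%N.
    by move=> as_; rewrite (big_rem _ as_) leq_addr.
  by apply: leq_add; exact: le_sum.
apply: (slln_indic_spaced pres (t := fun k => (l * k)%N)).
  by apply: sub_sigma_algebra; exists s, A.
move=> j k jk.
pose tr m := map (+%R^~ (h *+ (l * m))) s.
have utr m : uniq (tr m) by rewrite map_inj_uniq//; exact: addIr.
have pre m : iter (l * m) (shift h) @^-1` cylinder s A =
    cylinder (tr m) (fun i => A (i - h *+ (l * m))).
  by rewrite -shift_cylinder; apply/seteqP; split => x /=; rewrite iter_shift.
have Qtr m (A' : int -> set E) : (forall i, i \in s -> A' (i + h *+ (l * m)) = A i) ->
    (\prod_(i <- tr m) q (A' i) = Q (cylinder s A))%E.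
  move=> HA; rewrite Qcyl// big_map [LHS]big_seq [RHS]big_seq.
  by apply: eq_bigr => i is_; rewrite HA.
have disj i : i \in tr j -> i \in tr k -> False.
  move=> /mapP[a as_ ->] /mapP[b bs] E'.
  have := small _ _ as_ bs.
  have -> : a - b = h *+ (l * k) - h *+ (l * j).
    by apply/eqP; rewrite subr_eq addrAC eq_sym subr_eq eq_sym addrC -E'.
  have -> : h *+ (l * k) - h *+ (l * j) = h * l%:Z * (k%:Z - j%:Z).
    by rewrite -[h *+ (l * k)]mulr_natr -[h *+ (l * j)]mulr_natr !natrM !natz; ring.
  rewrite !abszM absz_nat ltnNge => /negP; apply.
  have : (0 < `|h|)%N by rewrite absz_gt0.
  have : (0 < `|(k%:Z - j%:Z)%R|)%N by rewrite absz_gt0 subr_eq0 eq_sym.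
  by move=> K0 H0; apply: leq_trans (leq_pmulr _ K0); exact: leq_pmull.
pose A2 i := if i \in tr j then A (i - h *+ (l * j)) else A (i - h *+ (l * k)).
rewrite !pre (_ : _ `&` _ = cylinder (tr j ++ tr k) A2).
  rewrite Qcyl.
  - rewrite big_cat/= !Qtr//.
      move=> i is_; rewrite /A2; case: ifP => [/disj|]; last by rewrite addrK.
      by move=> []; exact: (map_f (+%R^~ _)).
    by move=> i is_; rewrite /A2 ifT ?addrK//; exact: (map_f (+%R^~ _)).
  - rewrite cat_uniq !utr andbT /=; apply/hasPn => i ik; apply/negP => /disj; exact.
  - by move=> i; rewrite /A2; case: ifP.
apply/seteqP; split => x /=.
  move=> [H1 H2] i; rewrite mem_cat /A2; case: ifP => [ij _|_ /=]; [exact: H1|exact: H2].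
move=> H; split => i ij; have := H i; rewrite mem_cat ij ?orbT /A2 => /(_ isT).
  by rewrite ij.
by case: ifP => // /disj/(_ ij).
Qed.

End BernoulliShift.

Section PathLaw.
Context {d d' : measure_display} {T : measurableType d} {E : measurableType d'}.
Context {R : realType} (P : probability T R) (xi : int -> T -> E).
Hypothesis mxi : forall i, measurable_fun setT (xi i).

Definition trajectory (w : T) : path_space (E := E) := fun i => xi i w.

Lemma measurable_trajectory : measurable_fun setT trajectory.
Proof. exact: measurable_to_path. Qed.

Definition path_law : probability (path_space (E := E)) R :=
  distribution P (mfun_of measurable_trajectory).

Lemma path_law_cylinder : mutually_independent P xi ->
  identically_distributed P xi ->
  forall s A, uniq s -> (forall i, measurable (A i)) ->
  path_law (cylinder s A) =
    (\prod_(i <- s) distribution P (mfun_of (mxi 0)) (A i))%E.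
Proof.
move=> ind idd s A us mA.
transitivity (P (\bigcap_(i in [set` s]) (xi i @^-1` A i))).
  by congr (P _); apply/seteqP; split => x.
by rewrite ind//; apply: eq_bigr => i _; exact: idd.
Qed.

Lemma ae_path_law (A : set (path_space (E := E))) :
  {ae path_law, forall x, A x} -> {ae P, forall w, A (trajectory w)}.
Proof.
move=> [B [mB B0 AB]]; exists (trajectory @^-1` B); split => //.
- by rewrite -[X in measurable X]setTI; exact: measurable_trajectory.
- by move=> w /= nA; exact: AB.
Qed.

Lemma ge0_integral_path_law (f : path_space (E := E) -> \bar R) :
  measurable_fun setT f -> (forall x, 0 <= f x)%E ->
  (\int[path_law]_x f x = \int[P]_w f (trajectory w))%E.
Proof.
move=> mf f0.
have := @ge0_integral_pushforward _ _ _ _ _ _ measurable_trajectory P setT f measurableT mf.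
exact.
Qed.

Lemma integral_path_law (f : path_space (E := E) -> \bar R) :
  measurable_fun setT f ->
  (\int[path_law]_x f x = \int[P]_w f (trajectory w))%E.
Proof.
move=> mf; rewrite [LHS]integralE [RHS]integralE; congr (_ - _)%E.
  rewrite ge0_integral_path_law//; last exact: measurable_funepos.
  by apply: eq_integral => x _; rewrite !funeposE.
rewrite ge0_integral_path_law//; last exact: measurable_funeneg.
by apply: eq_integral => x _; rewrite !funenegE.
Qed.

End PathLaw.

(** * An integrable majorant of the logarithm *)

Section LogarithmTruncation.
Context {d : measure_display} {T : measurableType d} {R : realType}.
Variable Q : probability T R.

Lemma measurable_lne (a : T -> R) : measurable_fun setT a ->
  measurable_fun setT (fun x => lne (a x)%:E).
Proof.
move=> ma.
have -> : (fun x => lne (a x)%:E) =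
    (fun x => if a x <= 0 then -oo%E else (ln (a x))%:E).
  apply/funext => x; case: leP => ax; first by rewrite le0_lneNy.
  by rewrite lne_EFin.
apply: (@measurable_fun_ifT _ _ _ _ (fun=> -oo%E) _ (fun x => a x <= 0)) => //.
- by apply: measurable_fun_ler => //; exact: measurable_cst.
- by apply/measurable_EFinP; exact: (measurableT_comp (@measurable_ln R) ma).
Qed.

(** The logarithm of a may take the value -oo and have negative part of infinite
    integral.  Truncating it from below at -L keeps the integral negative for L
    large, by monotone convergence of the truncated negative parts. *)
Lemma exp_majorant (a : T -> R) : measurable_fun setT a ->
  (\int[Q]_x Order.max 0 (lne (a x)%:E) < +oo)%E ->
  (\int[Q]_x lne (a x)%:E < 0)%E ->
  exists g : T -> R, [/\ Q.-integrable setT (EFin \o g),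
    \int[Q]_x g x < 0 & forall x, a x <= expR (g x)].
Proof.
move=> ma Ipos Ineg.
pose f x := lne (a x)%:E.
have mf : measurable_fun setT f by exact: measurable_lne.
pose u x := (Order.max 0 (f x))%E.
pose v (L : nat) x := (Order.min (f^\- x) L%:R%:E)%E.
have mu_ : measurable_fun setT u by apply: measurable_maxe => //; exact: measurable_cst.
have mfn : measurable_fun setT f^\-%E by exact: measurable_funeneg.
have mv L : measurable_fun setT (v L) by apply: measurable_mine => //; exact: measurable_cst.
have u0 x : (0 <= u x)%E by rewrite /u le_max lexx.
have fn0 x : (0 <= f^\- x)%E by rewrite funenegE le_max lexx orbT.
have v0 L x : (0 <= v L x)%E by rewrite /v le_min fn0 lee_fin ler0n.
have fpu : f^\+%E = u by apply/funext => x; rewrite funeposE /u maxC.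
have Iu : (\int[Q]_x u x \is a fin_num)%E.
  by rewrite ge0_fin_numE// integral_ge0.
have lt_int : (\int[Q]_x u x < \int[Q]_x f^\- x)%E.
  move: Ineg; rewrite integralE -/f fpu.
  by rewrite lte_subel_addl// adde0.
have cv : (\int[Q]_x v L x)%E @[L --> \oo] --> (\int[Q]_x f^\- x)%E.
  rewrite (_ : (\int[Q]_x f^\- x)%E = (\int[Q]_x (limn (v ^~ x)))%E).
    apply: cvg_monotone_convergence => //.
    move=> x _ m n mn; rewrite /v le_min !ge_min lexx /=.
    by rewrite lee_fin ler_nat mn orbT.
  apply: eq_integral => x _; apply/esym/cvg_lim => //.
  rewrite /v; case E : (f^\- x)%E (fn0 x) => [r| |] //= r0.
    apply: cvg_near_cst; near=> L; apply: min_l; rewrite lee_fin.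
    by near: L; exact: nbhs_infty_ger.
  under eq_fun do rewrite min_r ?leey//.
  by apply/cvgeyPge => A; near=> L; rewrite lee_fin; near: L; exact: nbhs_infty_ger.
have [L HL] : exists L, (\int[Q]_x u x < \int[Q]_x v L x)%E.
  apply/not_existsP => H; move: lt_int; apply/negP; rewrite -leNgt.
  rewrite -(cvg_lim _ cv)//; apply: lime_le; first by apply/cvg_ex; eexists; exact: cv.
  by apply: nearW => n; rewrite leNgt; apply/negP; exact: H.
pose g x := ln (Num.max (a x) (expR (- L%:R))).
have gE x : (g x)%:E = (u x - v L x)%E.
  rewrite /g /u /v funenegE /f.
  have eL : 0 < expR (- L%:R) :> R by exact: expR_gt0.
  have [ax|ax] := leP (a x) 0.
    rewrite max_r; last by rewrite (le_trans ax)// ltW.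
    by rewrite le0_lneNy// expRK /= maxeNy add0e.
  rewrite lne_EFin//.
  have -> : ln (Num.max (a x) (expR (- L%:R))) = Num.max (ln (a x)) (- L%:R).
    case: leP => h; rewrite ?expRK.
      rewrite max_r// -(expRK (- L%:R)) ler_ln// posrE//.
    rewrite max_l// -(expRK (- L%:R)) ler_ln ?posrE//; exact: ltW.
  rewrite -EFinN -!EFin_max -EFin_min -EFinB; congr (_%:E).
  have L0 : 0 <= L%:R :> R by [].
  move: (ln (a x)) (L%:R) L0 => l M M0.
  rewrite /Num.max /Num.min.
  by case: (ltP l) => h1; case: (ltP 0 l) => h2; case: (ltP (-l) 0) => h3;
   case: ltP => h4; lra.
have mg : measurable_fun setT g.
  apply: (measurableT_comp (@measurable_ln R)).
  by apply: measurable_maxr => //; exact: measurable_cst.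
have Iv : (\int[Q]_x v L x \is a fin_num)%E.
  rewrite ge0_fin_numE ?integral_ge0//.
  apply: (@le_lt_trans _ _ (\int[Q]_x (L%:R)%:E)%E).
    apply: ge0_le_integral => //.
    by move=> x _; rewrite /v ge_min lexx orbT.
  by rewrite integral_cst// [X in (_ * X)%E](@probability_setT _ _ _ Q) mule1 ltry.
have ui : Q.-integrable setT u.
  apply/integrableP; split => //.
  under eq_integral do rewrite gee0_abs//.
  by rewrite ltey_eq Iu.
have vi : Q.-integrable setT (v L).
  apply/integrableP; split => //.
  under eq_integral do rewrite gee0_abs//.
  by rewrite ltey_eq Iv.
have gi : Q.-integrable setT (EFin \o g).
  rewrite (_ : EFin \o g = (u \- v L)%E); last by apply/funext => x /=; rewrite gE.
  exact: integrableB.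
exists g; split => //.
- rewrite -lte_fin fineK; last exact: (integrable_fin_num measurableT gi).
  under eq_integral do rewrite gE.
  by rewrite integralB// lteBlDr// add0e.
- move=> x; rewrite /g lnK; first by rewrite le_max lexx.
  by rewrite posrE lt_max expR_gt0 orbT.
Unshelve. all: by end_near. Qed.

End LogarithmTruncation.

(** * Submultiplicative matrix norms *)

Section MatrixNorms.
Context {R : realType} {p : nat}.
Variable N : 'M[R]_p -> R.
Hypothesis normN : is_matrix_norm N.

Lemma matrix_norm0 : N 0 = 0.
Proof. by case: normN => _ NZ _ _; rewrite -(scale0r 0) NZ normr0 mul0r. Qed.

Lemma matrix_normN A : N (- A) = N A.
Proof. by case: normN => _ NZ _ _; rewrite -scaleN1r NZ normrN1 mul1r. Qed.

Lemma matrix_norm_ge0 A : 0 <= N A.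
Proof.
case: normN => _ _ ND _; have := ND A (- A).
by rewrite subrr matrix_norm0 matrix_normN -mulr2n pmulrn_lge0.
Qed.

Lemma matrix_norm_sum (I : Type) (s : seq I) (A : I -> 'M[R]_p) :
  N (\sum_(i <- s) A i) <= \sum_(i <- s) N (A i).
Proof.
case: normN => _ _ ND _; elim: s => [|i s IH]; first by rewrite !big_nil matrix_norm0.
by rewrite !big_cons (le_trans (ND _ _))// lerD2l.
Qed.

Lemma matrix_norm_le_entries :
  exists2 C : R, 0 <= C & forall A : 'M[R]_p, N A <= C * \sum_i \sum_j `|A i j|.
Proof.
exists (\sum_i \sum_j N (delta_mx i j)).
  by do 2 (apply: sumr_ge0 => ? _); exact: matrix_norm_ge0.
move=> A; rewrite {1}(matrix_sum_delta A).
apply: (le_trans (matrix_norm_sum _ _)); rewrite mulr_sumr; apply: ler_sum => i _.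
apply: (le_trans (matrix_norm_sum _ _)); rewrite mulr_sumr; apply: ler_sum => j _.
case: normN => _ -> _ _; rewrite mulrC ler_wpM2r//.
rewrite (bigD1 i)//= (bigD1 j)//= -addrA lerDl addr_ge0//.
  by apply: sumr_ge0 => ? _; exact: matrix_norm_ge0.
by do 2 (apply: sumr_ge0 => ? _); exact: matrix_norm_ge0.
Qed.

(** Submultiplicativity replaces the compactness argument of the equivalence of
    norms: E_ii A E_ji = A_ij E_ii. *)
Lemma entries_le_matrix_norm :
  exists2 C : R, 0 <= C & forall (A : 'M[R]_p) i j, `|A i j| <= C * N A.
Proof.
case: normN => N0 NZ _ NM.
have npos i j : 0 < N (delta_mx i j).
  rewrite lt_neqAle matrix_norm_ge0 andbT eq_sym; apply/eqP => /N0/matrixP/(_ i j).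
  by rewrite !mxE !eqxx => /eqP; rewrite oner_eq0.
exists (\sum_i \sum_j N (delta_mx i i) * N (delta_mx j i) / N (delta_mx i i)).
  do 2 (apply: sumr_ge0 => ? _).
  by rewrite divr_ge0 ?mulr_ge0 ?matrix_norm_ge0.
move=> A i j.
have E : A i j *: delta_mx i i = delta_mx i i *m A *m delta_mx j i.
  apply/matrixP => k l; rewrite [LHS]mxE [RHS]mxE (bigD1 j)//= big1; last first.
    by move=> m mj; rewrite [delta_mx j i _ _]mxE (negbTE mj) mulr0.
  rewrite [(delta_mx i i *m A) k j]mxE (bigD1 i)//= big1; last first.
    by move=> m mi; rewrite mxE (negbTE mi) andbF mul0r.
  rewrite !addr0 !mxE !eqxx andbT /=.
  by case: (k == i); rewrite /= ?mul1r ?mul0r ?mulr0 1?mulrC.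
have : `|A i j| * N (delta_mx i i) <= N (delta_mx i i) * N A * N (delta_mx j i).
  rewrite -NZ E (le_trans (NM _ _))// ler_wpM2r ?matrix_norm_ge0//.
rewrite -ler_pdivlMr// => /le_trans; apply.
rewrite (mulrAC _ (N A)) (mulrAC _ (N A)).
rewrite ler_wpM2r ?matrix_norm_ge0//.
rewrite (bigD1 i)//= (bigD1 j)//= -addrA lerDl addr_ge0//.
  by apply: sumr_ge0 => ? _; rewrite divr_ge0 ?mulr_ge0 ?matrix_norm_ge0.
by do 2 (apply: sumr_ge0 => ? _); rewrite divr_ge0 ?mulr_ge0 ?matrix_norm_ge0.
Qed.

(** N is Lipschitz in the entries, so N A < c exactly when some rational matrix
    M satisfies N M + (Lipschitz bound on N (A - M)) < c: a countable union. *)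
Lemma measurable_matrix_norm d (T : measurableType d) (A : T -> 'M[R]_p) :
  (forall i j, measurable_fun setT (fun x => A x i j)) ->
  measurable_fun setT (fun x => N (A x)).
Proof.
move=> mA; have [C C0 NC] := matrix_norm_le_entries.
have [_ _ ND _] := normN.
pose D x (M : 'M[rat]_p) := C * \sum_i \sum_j `|A x i j - ratr (M i j)|.
have mD M : measurable_fun setT (D ^~ M).
  apply: measurable_funM; first exact: measurable_cst.
  apply: measurable_sum => i; apply: measurable_sum => j.
  apply: measurableT_comp => //; apply: measurable_funB => //.
apply: (measurability _ (RGenInftyO.measurableE R)).
move=> _ [_ [c ->] <-]; rewrite setTI.
rewrite (_ : _ @^-1` _ =
    \bigcup_(M : 'M[rat]_p) [set x | D x M < c - N (map_mx ratr M)]).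
  apply: countable_bigcupT_measurable => [|M]; first exact: countableP.
  rewrite [X in measurable X](_ : _ =
      setT `&` D ^~ M @^-1` `]-oo, c - N (map_mx ratr M)[%classic).
    by apply: mD.
  by apply/seteqP; split => x /=; rewrite in_itv//= => -[].
apply/seteqP; split => x /=; rewrite in_itv /=.
  move=> Nc; pose e := (c - N (A x)) / 2 / (C * (p * p)%:R + 1).
  have e0 : 0 < e.
    by rewrite divr_gt0 ?divr_gt0 ?subr_gt0// ltr_wpDl// mulr_ge0.
  have /choice[M0 HM0] : forall ij : 'I_p * 'I_p, exists q : rat,
      `|A x ij.1 ij.2 - ratr q| < e.
    move=> [i j] /=; have [|q] := @rat_in_itvoo R (A x i j - e) (A x i j + e).
      by rewrite ltrD2l gtrN.
    by rewrite in_itv /= => Hq; exists q; rewrite ltr_distlC.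
  pose M : 'M[rat]_p := \matrix_(i, j) M0 (i, j).
  exists M => //=.
  have DM : D x M <= (c - N (A x)) / 2 - e.
    apply: (@le_trans _ _ (C * ((p * p)%:R * e))).
      rewrite ler_wpM2l// (@le_trans _ _ (\sum_(i < p) \sum_(j < p) e))//.
        apply: ler_sum => i _; apply: ler_sum => j _; rewrite mxE.
        exact/ltW/(HM0 (i, j)).
      by rewrite !sumr_const !card_ord -mulrnA mulr_natl.
    have -> : (c - N (A x)) / 2 = e * (C * (p * p)%:R + 1).
      by rewrite /e divfK// gt_eqF// ltr_wpDl// mulr_ge0.
    by rewrite mulrDr mulr1 addrK mulrA mulrC.
  have NM : N (map_mx ratr M) <= N (A x) + D x M.
    rewrite -[map_mx ratr M](subrK (A x)) addrC (le_trans (ND _ _))// lerD2l.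
    rewrite -matrix_normN opprB (le_trans (NC _))// ler_wpM2l//.
    by apply: ler_sum => i _; apply: ler_sum => j _; rewrite !mxE.
  have lin (a b n m u : R) : 0 < u -> b <= (m - a) / 2 - u -> n <= a + b -> b < m - n.
    by lra.
  exact: lin e0 DM NM.
move=> [M _ /= H]; rewrite -[A x](subrK (map_mx ratr M)) (le_lt_trans (ND _ _))//.
rewrite -ltrBrDr (le_lt_trans (NC _))//; apply: le_lt_trans H.
rewrite ler_wpM2l//.
by apply: ler_sum => i _; apply: ler_sum => j _; rewrite !mxE.
Qed.

End MatrixNorms.

(** * The causal solution of the state equation *)

Section CausalSolution.
Context {R : realType} {p : nat}.
Variables theta alpha : 'cV[R]_p.

Local Notation Om := (path_space (E := (p.+1.-tuple R : measurableType _))).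

Definition noise_mx (u : p.+1.-tuple R) : 'M[R]_p :=
  \matrix_(i, j) (if i == 0%N :> nat then tnth u (lift ord0 j) else 0).

(** In what follows, coordinate 0 of a trajectory is the present and
    coordinate -1 the previous time. *)
Definition step_mx (x : Om) : 'M[R]_p :=
  companion theta + noise_mx (x (-1)) *m diag_mx alpha^T + noise_mx (x 0).

Definition step_noise (x : Om) : 'cV[R]_p :=
  \col_i (if i == 0%N :> nat then tnth (x 0) ord0 else 0).

Fixpoint transfer_mx (m : nat) (x : Om) : 'M[R]_p :=
  if m is k.+1 then step_mx x *m transfer_mx k (shift (-1) x) else 1%:M.

(** The present state when the recursion is started from 0, m steps ago. *)
Fixpoint truncated_state (m : nat) (x : Om) : 'cV[R]_p :=
  if m is k.+1
  then step_mx x *m truncated_state k (shift (-1) x) + step_noise x else 0.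

Lemma shift_shift (a b : int) (x : Om) : shift a (shift b x) = shift (a + b) x.
Proof. by apply/funext => i; rewrite /shift addrA. Qed.

Lemma truncation_error (x : Om) (Y : int -> 'cV[R]_p) :
  (forall t, Y t = step_mx (shift t x) *m Y (t - 1) + step_noise (shift t x)) ->
  forall m t, Y t - truncated_state m (shift t x) =
    transfer_mx m (shift t x) *m Y (t - m%:Z).
Proof.
move=> HY; elim=> [|m IH] t; first by rewrite /= !subr0 mul1mx.
rewrite /= {1}HY opprD addrACA subrr addr0 -mulmxBr -mulmxA.
have -> : shift (-1) (shift t x) = shift (t - 1) x by rewrite shift_shift addrC.
by rewrite IH; congr (_ *m (_ *m Y _)); lia.
Qed.

Lemma measurable_noise_mx i i' j :
  measurable_fun setT (fun x : Om => noise_mx (x i) i' j).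
Proof.
have [i0|i0] := eqVneq (i' : nat) 0%N.
  have -> : (fun x : Om => noise_mx (x i) i' j) =
      (fun u => tnth u (lift ord0 j)) \o (fun x : Om => x i).
    by apply/funext => x; rewrite mxE i0.
  by apply: measurableT_comp; [exact: measurable_tnth|exact: measurable_coord].
rewrite (_ : (fun x => _) = fun=> 0); first exact: measurable_cst.
by apply/funext => x; rewrite mxE (negbTE i0).
Qed.

Lemma measurable_step_mx i j : measurable_fun setT (fun x => step_mx x i j).
Proof.
rewrite (_ : (fun x => _) = fun x => companion theta i j +
    noise_mx (x (-1)) i j * alpha j 0 + noise_mx (x 0) i j).
  apply: measurable_funD; last exact: measurable_noise_mx.
  apply: measurable_funD; first exact: measurable_cst.
  by apply: measurable_funM; [exact: measurable_noise_mx | exact: measurable_cst].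
apply/funext => x; rewrite /step_mx 2!mxE mul_mx_diag; congr (_ + _ + _).
by rewrite !mxE.
Qed.

Lemma measurable_step_noise i : measurable_fun setT (fun x => step_noise x i 0).
Proof.
have [i0|i0] := eqVneq (i : nat) 0%N.
  have -> : (fun x : Om => step_noise x i 0) =
      (fun u => tnth u ord0) \o (fun x : Om => x 0).
    by apply/funext => x; rewrite mxE i0.
  by apply: measurableT_comp; [exact: measurable_tnth|exact: measurable_coord].
rewrite (_ : (fun x => _) = fun=> 0); first exact: measurable_cst.
by apply/funext => x; rewrite mxE (negbTE i0).
Qed.

Lemma measurable_truncated_state m i :
  measurable_fun setT (fun x => truncated_state m x i 0).
Proof.
elim: m i => [|m IH] i /=.
  rewrite (_ : (fun x => _) = fun=> 0); first exact: measurable_cst.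
  by apply/funext => x; rewrite mxE.
rewrite (_ : (fun x => _) = fun x =>
    \sum_j step_mx x i j * truncated_state m (shift (-1) x) j 0
    + step_noise x i 0).
  apply: measurable_funD; last exact: measurable_step_noise.
  apply: measurable_sum => j; apply: measurable_funM.
    exact: measurable_step_mx.
  exact: (measurableT_comp (IH j) (measurable_shift (-1))).
by apply/funext => x; rewrite mxE [in LHS]mxE.
Qed.

(** The upper limit makes this measurable and defined on every trajectory; it is
    a limit on almost all of them. *)
Definition state (i : 'I_p) (x : Om) : R :=
  fine (limn_esup (fun m => (truncated_state m x i 0)%:E)).

Lemma measurable_state i : measurable_fun setT (state i).
Proof.
apply: measurableT_comp => //.
apply: measurable_fun_limn_esup => m.
by apply/measurable_EFinP; exact: measurable_truncated_state.
Qed.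

Lemma state_cvg i x (l : R) :
  truncated_state m x i 0 @[m --> \oo] --> l -> state i x = l.
Proof.
move=> H; rewrite /state.
have Hl : (truncated_state m x i 0)%:E @[m --> \oo] --> l%:E.
  by apply: cvg_EFin => //; exact: nearW.
by rewrite (is_cvg_limn_esupE (cvgP _ Hl)) (cvg_lim _ Hl).
Qed.

Variable N : 'M[R]_p -> R.
Hypothesis normN : is_matrix_norm N.

Lemma transfer_mx_norm (g : Om -> R) : (forall x, N (step_mx x) <= expR (g x)) ->
  forall m x, N (transfer_mx m x) <=
    N 1%:M * expR (\sum_(0 <= k < m) g (iter k (shift (-1)) x)).
Proof.
move=> Ng; have [_ _ _ NM] := normN.
elim=> [|m IH] x; first by rewrite big_geq// expR0 mulr1.
rewrite /= big_nat_recl//= expRD mulrCA (le_trans (NM _ _))//.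
rewrite ler_pM ?matrix_norm_ge0//.
apply: (le_trans (IH _)); rewrite ler_wpM2l ?matrix_norm_ge0// ler_expR.
by apply: ler_sum => k _; rewrite -iterSr.
Qed.

(** The matrix product is O(exp (-2 c m)) and the state it multiplies is
    O(exp (c m)), so the truncation error is O(exp (- c m)). *)
Lemma truncated_state_cvg (g : Om -> R) (x : Om) (Y : int -> 'cV[R]_p)
    (c : R) (t : int) :
  (forall x, N (step_mx x) <= expR (g x)) ->
  (forall t, Y t = step_mx (shift t x) *m Y (t - 1) + step_noise (shift t x)) ->
  0 < c ->
  (\forall m \near \oo,
     \sum_(0 <= k < m) g (iter k (shift (-1)) (shift t x)) <= - (2 * c) * m%:R) ->
  (forall j, \forall m \near \oo, `|Y (t - m%:Z) j 0| <= expR (c * m%:R)) ->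
  forall i, truncated_state m (shift t x) i 0 @[m --> \oo] --> Y t i 0.
Proof.
move=> Ng HY c0 Hg HX i.
have [C C0 HC] := entries_le_matrix_norm normN.
have HXall : \forall m \near \oo, forall j, `|Y (t - m%:Z) j 0| <= expR (c * m%:R).
  exact: filter_forall.
pose K := C * N 1%:M * p%:R.
have K0 : 0 <= K by rewrite !mulr_ge0 ?matrix_norm_ge0.
have cvK : K * expR (- c) ^+ m @[m --> \oo] --> 0.
  rewrite -[X in _ --> X](mulr0 K); apply: cvgMr; apply: cvg_expr.
  by rewrite ger0_norm ?expR_ge0// -expR0 ltr_expR oppr_lt0.
apply/cvgrPdist_le => e e0.
have /cvgrPdist_le/(_ _ e0) := cvK.
move: Hg HXall; apply: filterS3 => m Hg HX' He.
rewrite (_ : Y t i 0 - _ = (Y t - truncated_state m (shift t x)) i 0); last by rewrite !mxE.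
rewrite (truncation_error HY) mxE.
apply: (le_trans (ler_norm_sum _ _ _)); apply: le_trans He.
rewrite sub0r normrN [leRHS]ger0_norm; last by rewrite mulr_ge0// exprn_ge0// expR_ge0.
apply: (@le_trans _ _ (\sum_(j < p) C * N 1%:M * expR (- c) ^+ m)).
  apply: ler_sum => j _; rewrite normrM.
  apply: (@le_trans _ _ ((C * (N 1%:M * expR (- (2 * c) * m%:R))) * expR (c * m%:R))).
    rewrite ler_pM//; apply: (le_trans (HC _ _ _)); rewrite ler_wpM2l//.
    apply: (le_trans (transfer_mx_norm Ng _ _)); rewrite ler_wpM2l ?matrix_norm_ge0//.
    by rewrite ler_expR.
  rewrite -!mulrA -expRD -expRM_natr -mulrDl.
  have -> : - (2 * c) + c = - c by ring.
  by [].
by rewrite sumr_const card_ord -mulr_natr /K mulrAC.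
Qed.

End CausalSolution.

(** * Subexponential growth of an identically distributed sequence *)

Section AlmostSure.
Context {d : measure_display} {T : measurableType d} {R : realType}.
Variable P : probability T R.

Lemma ae_forall_int (A : int -> T -> Prop) :
  (forall t, {ae P, forall w, A t w}) -> {ae P, forall w, forall t, A t w}.
Proof.
move=> H.
have H1 : {ae P, forall w, forall n : nat, A (Posz n) w} by apply: ae_foralln => n.
have H2 : {ae P, forall w, forall n : nat, A (Negz n) w} by apply: ae_foralln => n.
by apply: filterS2 H1 H2 => w h1 h2 [n|n].
Qed.

Lemma chebyshev_tail (Z : T -> R) (a : R) : measurable_fun setT Z ->
  P.-integrable setT (fun w => (Z w ^+ 2)%:E) -> 0 < a ->
  (P [set w | (a < `|Z w|)%R] <= ((\int[P]_w (Z w ^+ 2)) / a ^+ 2)%:E)%E.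
Proof.
move=> mZ iZ a0.
have mF : measurable [set w | a < `|Z w|].
  exact/measurable_superlevel/(measurableT_comp (@normr_measurable R setT) mZ).
rewrite -[leLHS]fineK ?fin_num_measure// lee_fin ler_pdivlMr ?exprn_gt0// mulrC.
rewrite -(Rintegral_indic P mF) -RintegralZl//; last exact: indic_integrable.
apply: le_Rintegral => //.
  exact: (integrableZl measurableT (a ^+ 2) (indic_integrable P mF)).
move=> w _; rewrite indicE; have [/set_mem/= aZ|_] := boolP (w \in _).
  by rewrite mulr1 -(real_normK (num_real (Z w))) lerXn2r ?nnegrE ?(ltW a0)// ltW.
by rewrite mulr0 sqr_ge0.
Qed.

(** By Chebyshev's inequality the tails at exp (c m) are dominated by a
    geometric sequence; the Borel-Cantelli lemma concludes. *)
Lemma eventually_exp_bounded (Y : nat -> T -> R) (Z : T -> R) (c : R) :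
  0 < c -> (forall m, measurable_fun setT (Y m)) -> measurable_fun setT Z ->
  P.-integrable setT (fun w => (Z w ^+ 2)%:E) ->
  (forall m a, P [set w | a < `|Y m w|] = P [set w | a < `|Z w|]) ->
  {ae P, forall w, \forall m \near \oo, `|Y m w| <= expR (c * m%:R)}.
Proof.
move=> c0 mY mZ iZ PYZ.
pose F m := [set w | expR (c * m%:R) < `|Y m w|].
have mF m : measurable (F m).
  exact/measurable_superlevel/(measurableT_comp (@normr_measurable R setT) (mY m)).
pose K := \int[P]_w (Z w ^+ 2).
have K0 : 0 <= K by apply: Rintegral_ge0 => w _; exact: sqr_ge0.
pose r := expR (- (2 * c)).
have r0 : 0 < r by exact: expR_gt0.
have r1 : r < 1 by rewrite -expR0 ltr_expR oppr_lt0 mulr_gt0.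
have PF m : (P (F m) <= (geometric K r m)%:E)%E.
  rewrite /F PYZ; apply: (le_trans (chebyshev_tail mZ iZ (expR_gt0 _))).
  rewrite lee_fin /geometric /= ler_wpM2l// -expRM_natl -expRN -expRM_natr.
  by rewrite ler_expR mulNr mulrA.
have sum_fin : (\sum_(m <oo) P (F m) < +oo)%E.
  apply: (@le_lt_trans _ _ (K / (1 - r))%:E); last exact: ltry.
  apply: lime_le; first exact: is_cvg_nneseries.
  apply: nearW => n.
  apply: (@le_trans _ _ (\sum_(0 <= m < n) (geometric K r m)%:E)%E).
    by apply: lee_sum => m _; exact: PF.
  rewrite sumEFin lee_fin; apply: geometric_le_lim => //.
  by rewrite ger0_norm// ltW.
have H0 := lim_sup_set_cvg0 mF sum_fin.
exists (lim_sup_set F); split => //.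
  apply: bigcapT_measurable => n; apply: bigcup_measurable => m _; exact: mF.
move=> w /= nb n _; apply: contrapT => H; apply: nb.
exists n => // m nm /=; rewrite leNgt; apply/negP => Hm; apply: H.
by exists m.
Qed.

End AlmostSure.

(** * Stationary solutions and their autocovariances *)

Section StationarySolution.
Context {d : measure_display} {T : measurableType d} {R : realType}.
Variables (P : probability T R) (p : nat).
Hypothesis p_gt0 : (0 < p)%N.
Variables theta alpha : 'cV[R]_p.
Variables (eps : int -> {RV P >-> R}) (eta : 'I_p -> int -> {RV P >-> R}).
Variable X : int -> {RV P >-> R}.
Hypothesis noise : strong_white_noises eps eta.
Hypothesis stable : stability theta alpha eps eta.
Hypothesis model : rcar_equation theta alpha eps eta X.
Hypothesis stationary : strictly_stationary P X.
Hypothesis square_integrable :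
  forall t, P.-integrable setT (fun w => (X t w ^+ 2)%:E).

Local Notation xi := (innovation eps eta).
Local Notation step := (step_mx theta alpha).

Lemma measurable_innovation t : measurable_fun setT (xi t).
Proof.
apply: measurable_cons => //.
apply/measurable_fun_tnthP => k.
rewrite (_ : _ \o _ = eta k t)//.
by apply/funext => w /=; rewrite tnth_mktuple.
Qed.

Local Notation Q := (path_law P measurable_innovation).

Lemma innovation_noise_mx t w : noise_mx (xi t w) = Nmat eta t w.
Proof.
apply/matrixP => i j; rewrite !mxE; case: eqP => // _.
by rewrite tnthS tnth_mktuple.
Qed.

Lemma step_mx_path t w : step (shift t (trajectory xi w)) =
  companion theta + Nmat eta (t - 1) w *m diag_mx alpha^T + Nmat eta t w.
Proof.
rewrite /step_mx /shift /trajectory -!innovation_noise_mx.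
by rewrite add0r [-1 + t]addrC.
Qed.

Lemma path_law_product : forall s A, uniq s -> (forall i, measurable (A i)) ->
  Q (cylinder s A) =
  (\prod_(i <- s) distribution P (mfun_of (measurable_innovation 0)) (A i))%E.
Proof. by case: noise => ind idd _ _; exact: path_law_cylinder. Qed.

Lemma shift_preserving h : measure_preserving Q (shift h).
Proof. exact: (shift_measure_preserving path_law_product). Qed.

(** The shift preserves the law of the trajectory, so an almost sure property of
    the trajectory holds almost surely from all the countably many origins of
    time. *)
Lemma ae_all_times (A : set (path_space (E := (p.+1.-tuple R : measurableType _)))) :
  {ae Q, forall x, A x} -> {ae P, forall w, forall t, A (shift t (trajectory xi w))}.
Proof.
move=> H; apply: ae_forall_int => t.
apply: (ae_path_law (mxi := measurable_innovation) (A := fun x => A (shift t x))).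
exact: (ae_measure_preserving (shift_preserving t) H).
Qed.

Lemma ae_state_equation : {ae P, forall w, forall t,
  Phi X t w = step (shift t (trajectory xi w)) *m Phi X (t - 1) w
              + step_noise (shift t (trajectory xi w))}.
Proof.
have H := ae_forall_int model.
apply: filterS H => w Hw t; apply/matrixP => i j; rewrite (ord1 j) !mxE.
rewrite step_mx_path.
have [i0|i0] := eqVneq (i : nat) 0%N.
  rewrite i0 subr0 Hw /shift /trajectory add0r; congr (_ + _).
  apply: eq_bigr => k _; rewrite 2!mxE mul_mx_diag !mxE i0 /=.
  rewrite [_ * alpha k 0]mulrC; congr (_ * X _ w); lia.
rewrite addr0.
have i1 : (i.-1 < p)%N by rewrite (leq_ltn_trans (leq_pred i)).
rewrite (bigD1 (Ordinal i1))//= big1 ?addr0.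
  rewrite 2!mxE mul_mx_diag !mxE (negbTE i0) /= prednK ?lt0n// eqxx mul0r !addr0 mul1r.
  congr (X _ w); move: i0; lia.
move=> k ki; rewrite 2!mxE mul_mx_diag !mxE (negbTE i0) /= mul0r !addr0.
case: eqP => [E|]; last by rewrite mul0r.
by case/eqP: ki; apply/val_inj; rewrite /= E.
Qed.

Lemma tail_stationary t m a :
  P [set w | a < `|X (t - m) w|] = P [set w | a < `|X t w|].
Proof.
pose B := [set u : 1.-tuple R | a < `|tnth u ord0|].
have mB : measurable B.
  apply: measurable_superlevel.
  exact: (measurableT_comp (@normr_measurable R setT) (measurable_tnth ord0)).
have := stationary (fun _ : 'I_1 => t) (- m) mB.
rewrite (_ : _ @^-1` B = [set w | a < `|X (t - m) w|]); last first.
  by apply/seteqP; split => w; rewrite /B /= tnth_mktuple.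
rewrite (_ : _ @^-1` B = [set w | a < `|X t w|])//.
by apply/seteqP; split => w; rewrite /B /= tnth_mktuple.
Qed.

Let first : 'I_p := Ordinal p_gt0.

(** A stationary solution can only be the causal one: it is the limit of the
    truncated recursions, whose error vanishes since the random matrix products
    decay exponentially while the past states are identically distributed. *)
Lemma ae_causal : {ae P, forall w, forall t,
  X t w = state theta alpha first (shift t (trajectory xi w))}.
Proof.
have [[N [normN Npos Nneg]] _] := stable.
have mN : measurable_fun setT (fun x => N (step x)).
  by apply: measurable_matrix_norm => // i j; exact: measurable_step_mx.
have EA w : companion theta + Nmat eta 0 w *m diag_mx alpha^T + Nmat eta 1 w =
    step (shift 1 (trajectory xi w)) by rewrite step_mx_path subrr.
have ml := measurable_lne mN.
have mm : measurable_fun setT (fun x => Order.max 0 (lne (N (step x))%:E))%E.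
  by apply: measurable_maxe => //; exact: measurable_cst.
have tr f : measurable_fun setT f ->
    (\int[P]_w f (shift 1 (trajectory xi w)) = \int[Q]_x f x)%E.
  move=> mf; rewrite -(integral_measure_preserving (shift_preserving 1) mf).
  rewrite integral_path_law//.
  exact: (measurableT_comp mf (measurable_shift 1)).
have Qpos : (\int[Q]_x Order.max 0 (lne (N (step x))%:E) < +oo)%E.
  rewrite -(tr _ mm); move: Npos.
  by under eq_integral do rewrite EA.
have Qneg : (\int[Q]_x lne (N (step x))%:E < 0)%E.
  rewrite -(tr _ ml); move: Nneg.
  by under eq_integral do rewrite EA.
have [g [gi gneg Ng]] := exp_majorant mN Qpos Qneg.
(* The products decay at rate - \int g = 4 c almost surely; half of that rate
   is kept for large times, and c is given up to the growth of the past. *)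
pose c := - (\int[Q]_x g x) / 4.
have c0 : 0 < c by rewrite divr_gt0// oppr_gt0.
have h1 : (-1 : int) != 0 by [].
have [_ /ae_all_times Hg] := bernoulli_slln path_law_product h1 gi.
have HX : {ae P, forall w, forall t, \forall m \near \oo,
    `|X (t - m%:Z) w| <= expR (c * m%:R)}.
  apply: ae_forall_int => t.
  apply: (eventually_exp_bounded (Z := X t)) => //.
  by move=> m a; exact: tail_stationary.
apply: filterS3 ae_state_equation Hg HX => w HPhi Hg HX t.
apply/esym/state_cvg.
have -> : X t w = Phi X t w first 0 by rewrite mxE subr0.
apply: (truncated_state_cvg normN Ng HPhi c0).
  have gc : \int[Q]_x g x < - (2 * c).
    by rewrite /c; lra.
  have near_lt : \forall m \near \oo, time_mean (shift (-1)) g m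
      (shift t (trajectory xi w)) < - (2 * c) by exact: (cvgr_lt _ (Hg t) _ gc).
  apply: filterS near_lt => -[|m] Hm; first by rewrite big_geq// mulr0.
  apply: ltW; move: Hm; rewrite /time_mean ltr_pdivrMl ?ltr0n//.
  by rewrite mulrC.
move=> j; apply: filterS (HX (t - j%:Z)) => m Hm.
by rewrite mxE addrAC.
Qed.

Lemma ae_autocovariance (i : nat) (u : int) : {ae P, forall w,
  n%:R^-1 * (\sum_(0 <= k < n) X (k%:Z + u + i%:Z) w * X (k%:Z + u) w)
    @[n --> \oo] --> ell X i}.
Proof.
pose s := state theta alpha first.
pose F x := s (shift i%:Z x) * s x.
have ms : measurable_fun setT s by exact: measurable_state.
have mF : measurable_fun setT F.
  by apply: measurable_funM => //; exact: (measurableT_comp ms (measurable_shift _)).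
have XF : {ae P, forall w, forall t,
    X (t + i%:Z) w * X t w = F (shift t (trajectory xi w))}.
  apply: filterS ae_causal => w Hw t.
  by rewrite /F shift_shift [i%:Z + t]addrC !Hw.
have iXX : P.-integrable setT (fun w => (X i%:Z w * X 0 w)%:E).
  have i1 := integrableZl measurableT (2^-1 : R) (integrableD measurableT
    (square_integrable i%:Z) (square_integrable 0)).
  apply: (le_integrable measurableT _ _ i1) => //.
    by apply/measurable_EFinP; exact: measurable_funM.
  move=> w _; rewrite -EFinD -EFinM lee_fin.
  exact: le_trans (normrM_le_sqr _ _) (ler_norm _).
have XF0 : {ae P, forall w, setT w -> (X i%:Z w * X 0 w)%:E = (F (trajectory xi w))%:E}.
  apply: filterS XF => w /(_ 0) + _.
  rewrite add0r => ->; congr (F _)%:E.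
  by apply/funext => j; rewrite /shift addr0.
have mFp : measurable_fun setT (fun w => (F (trajectory xi w))%:E).
  apply/measurable_EFinP.
  exact: (measurableT_comp mF (measurable_trajectory measurable_innovation)).
have iFp : P.-integrable setT (fun w => (F (trajectory xi w))%:E).
  apply/integrableP; split => //; case/integrableP: iXX => mXX; apply: le_lt_trans.
  apply: ae_ge0_le_integral => //; try exact: measurableT_comp.
  by apply: filterS XF0 => w H /H <-.
have iF : Q.-integrable setT (EFin \o F).
  have mFE : measurable_fun setT (EFin \o F) by exact/measurable_EFinP.
  exact: (@integrable_pushforward _ _ _ _ R (trajectory xi)
    (measurable_trajectory measurable_innovation) P setT _ mFE iFp measurableT).
have EF : \int[Q]_x F x = ell X i.
  rewrite /ell /Ex unlock /Rintegral integral_path_law//; last exact/measurable_EFinP.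
  congr fine; apply/esym; apply: ae_eq_integral => //.
  exact: (measurable_int _ iXX).
have h1 : (1 : int) != 0 by [].
have [_ /ae_all_times HF] := bernoulli_slln path_law_product h1 iF.
apply: filterS2 XF HF => w HX /(_ u); rewrite EF.
apply: cvg_trans; apply: near_eq_cvg; apply: nearW => n.
rewrite /time_mean; congr (_ * _); apply: eq_bigr => k _.
by rewrite iter_shift shift_shift -HX natz.
Qed.

End StationarySolution.

(** * Limits of solutions of linear systems *)

Section MatrixLimits.
Context {R : realType}.

Lemma cvg_mx_entries m n (A : nat -> 'M[R]_(m, n)) (B : 'M[R]_(m, n)) :
  (forall i j, A k i j @[k --> \oo] --> B i j) -> A k @[k --> \oo] --> B.
Proof.
move=> H; apply/cvg_ballP => e e0.
have H' : \forall k \near \oo, forall ij : 'I_m * 'I_n,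
    ball (B ij.1 ij.2) e (A k ij.1 ij.2).
  apply: filter_forall => -[i j] /=; have /cvg_ballP := H i j; exact.
by apply: filterS H' => k Hk; split => // i j; exact: (Hk (i, j)).
Qed.

Lemma cvg_det n (A : nat -> 'M[R]_n) (B : 'M[R]_n) :
  (forall i j, A k i j @[k --> \oo] --> B i j) ->
  \det (A k) @[k --> \oo] --> \det B.
Proof.
move=> H; apply: cvg_big => [|s _]; first exact: add_continuous.
apply: cvgMr; apply: cvg_big => [|i _]; first exact: mul_continuous.
exact: H.
Qed.

Lemma cvg_unitmx n (A : nat -> 'M[R]_n) (B : 'M[R]_n) :
  (forall i j, A k i j @[k --> \oo] --> B i j) -> B \in unitmx ->
  \forall k \near \oo, A k \in unitmx.
Proof.
move=> HA; rewrite unitmxE unitfE => dB.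
have : \forall k \near \oo, \det (A k) != 0 by exact: (cvgr_neq0 _ (cvg_det HA) dB).
by apply: filterS => k; rewrite unitmxE unitfE.
Qed.

(** Cramer's rule expresses the solution by determinants, which are continuous
    in the entries. *)
Lemma cvg_solve n (A : nat -> 'M[R]_n) (B : 'M[R]_n)
    (v : nat -> 'cV[R]_n) (u : 'cV[R]_n) :
  (forall i j, A k i j @[k --> \oo] --> B i j) ->
  (forall i, v k i 0 @[k --> \oo] --> u i 0) ->
  B \in unitmx ->
  invmx (A k) *m v k @[k --> \oo] --> invmx B *m u.
Proof.
move=> HA Hv uB.
have dB : \det B != 0 by rewrite -unitfE -unitmxE.
have cd := cvg_det HA.
have near_unit := cvg_unitmx HA uB.
have adjE (M : 'M[R]_n) (z : 'cV[R]_n) i : M \in unitmx ->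
    (invmx M *m z) i 0 = \sum_j (\det M)^-1 * \adj M i j * z j 0.
  move=> uM; rewrite mxE; apply: eq_bigr => j _.
  by rewrite /invmx uM mxE.
apply: cvg_mx_entries => i j; rewrite (ord1 j) adjE//.
apply: (@cvg_trans _ ((\sum_j (\det (A k))^-1 * \adj (A k) i j * v k j 0) @[k --> \oo])).
  by apply: near_eq_cvg; apply: filterS near_unit => k uk; rewrite adjE.
apply: cvg_big => [|l _]; first exact: add_continuous.
apply: cvgM => //; apply: cvgM; first exact: cvgV.
under eq_fun do rewrite mxE; rewrite mxE.
apply: cvgMr; apply: cvg_det => a b.
by under eq_fun do rewrite !mxE; rewrite !mxE; exact: HA.
Qed.

End MatrixLimits.

(** * Consistency of the least squares estimator *)

Theorem theorem2p1 (d : measure_display) (T : measurableType d) (R : realType)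
    (P : probability T R) (p : nat) (p_gt0 : (0 < p)%N)
    (theta alpha : 'cV[R]_p)
    (eps : int -> {RV P >-> R}) (eta : 'I_p -> int -> {RV P >-> R})
    (X : int -> {RV P >-> R})
    (noise : strong_white_noises eps eta)
    (stable : stability theta alpha eps eta)
    (model : rcar_equation theta alpha eps eta X)
    (stationary : strictly_stationary P X)
    (U : 'cV[R]_p) (HU : decomposition_vector theta alpha eps eta X U)
    (Theta2 : in_Theta eps eta X 2)
    (Theta_star : ~ in_Theta_star theta alpha eps eta X U) :
  {ae P, forall w,
    theta_hat p X n w @[n --> \oo] --> invmx (Lambda0 p X) *m L1 p X}.
Proof.
have uL : Lambda0 p X \in unitmx.
  by apply/negP => /negP nu; apply: Theta_star; left.
have X2 t : P.-integrable setT (fun w => (X t w ^+ 2)%:E).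
  have [_ _ /(_ (Ordinal p_gt0) 0%N t isT)] := Theta2.
  by under eq_fun do rewrite expr0 mul1r.
have H : {ae P, forall w, forall i : nat, forall u : int,
  n%:R^-1 * (\sum_(0 <= k < n) X (k%:Z + u + i%:Z) w * X (k%:Z + u) w)
    @[n --> \oo] --> ell X i}.
  apply: ae_foralln => i; apply: ae_forall_int => u.
  exact: (ae_autocovariance p_gt0 noise stable model stationary X2).
apply: filterS H => w Hw.
pose A n : 'M[R]_p := n%:R^-1 *: Smat X n.-1 w.
pose v n : 'cV[R]_p :=
  n%:R^-1 *: \sum_(1 <= t < n.+1) X t%:Z w *: Phi (p := p) X (t%:Z - 1) w.
have Hsym (a b : int) : n%:R^-1 * (\sum_(0 <= k < n) X (k%:Z - a) w * X (k%:Z - b) w)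
    @[n --> \oo] --> ell X `|a - b|%N.
  have [ab|/ltW ab] := leP a b.
    have := Hw `|a - b|%N (- b).
    apply: cvg_trans; apply: near_eq_cvg; apply: nearW => n; congr (_ * _).
    apply: eq_bigr => k _; congr (X _ w * _); lia.
  have := Hw `|a - b|%N (- a).
  apply: cvg_trans; apply: near_eq_cvg; apply: nearW => n; congr (_ * _).
  apply: eq_bigr => k _; rewrite mulrC; congr (_ * X _ w); lia.
have cA i j : A n i j @[n --> \oo] --> Lambda0 p X i j.
  rewrite mxE; have := Hsym i j.
  apply: cvg_trans; apply: near_eq_cvg; exists 1%N => // -[|n] //= _.
  rewrite mxE summxE; congr (_ * _); apply: eq_bigr => k _.
  by rewrite mxE big_ord1 !mxE.
have cv i : v n i 0 @[n --> \oo] --> L1 p X i 0.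
  (* The response X_t is one step ahead of the regressor, which is lag -1. *)
  rewrite mxE; have := Hsym (-1) i.
  rewrite (_ : absz (-1 - i%:Z)%R = i.+1); last by lia.
  apply: cvg_trans; apply: near_eq_cvg; apply: nearW => n.
  rewrite mxE summxE big_add1; congr (_ * _); apply: eq_bigr => k _.
  rewrite !mxE; congr (X _ w * X _ w); lia.
(* Dividing both sums by n does not change the estimator once the matrix is
   invertible; for singular matrices invmx is the identity map. *)
have := cvg_solve cA cv uL.
apply: cvg_trans; apply: near_eq_cvg.
have n_gt0 : \forall n \near \oo, (0 < n)%N by exists 1%N.
apply: filterS2 n_gt0 (cvg_unitmx cA uL) => n n0.
have n1 : (n%:R^-1 : R) \is a GRing.unit by rewrite unitfE invr_eq0 pnatr_eq0 -lt0n.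
rewrite /A unitmxZ// => uS; rewrite /theta_hat /v invmxZ ?unitmxZ//.
by rewrite -scalemxAl -scalemxAr scalerA mulVr// scale1r.
Qed.
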